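(* Let $K$ be a field of characteristic $0$, let $n\in\mathbb{N}$, let $A=A_n(K)$ be the $n$-th Weyl algebra over $K$, and let $\varphi:A\to A$ be a $K$-algebra endomorphism with image $S=\varphi(A)$. If $A$ is finitely generated as a left $S$-module, or finitely generated as a right $S$-module (with $S$ acting by multiplication in $A$), then $S=A$.
   Context: For a commutative ring $R$, the $n$-th Weyl algebra $A_n(R)$ is the $R$-algebra generated by $x_1,\dots,x_n,\partial_1,\dots,\partial_n$ subject to the relations $[x_i,x_j]=0$, $[\partial_i,\partial_j]=0$, $[\partial_i,x_j]=\delta_{ij}$ for $i,j=1,\dots,n$, where $[a,b]=ab-ba$. *)

(* Defs.v *)
From HB Require Import structures.
From mathcomp Require Import all_boot all_order all_algebra.
Set Implicit Arguments. Unset Strict Implicit. Unset Printing Implicit Defensive.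
Import GRing.Theory.
Local Open Scope ring_scope.

Definition weyl_rels (K : fieldType) (B : algType K) (n : nat)
    (x d : 'I_n -> B) : Prop :=
  [/\ forall i j, x i * x j - x j * x i = 0,
      forall i j, d i * d j - d j * d i = 0 &
      forall i j, d i * x j - x j * d i = (i == j)%:R].

(* (A, x, d) is the n-th Weyl algebra over K: the K-algebra generated by the
   x_i, d_i subject to exactly the Weyl relations, i.e. it satisfies the
   relations and has the universal property of this presentation. *)
Definition is_weyl_algebra (K : fieldType) (n : nat) (A : algType K)
    (x d : 'I_n -> A) : Prop :=
  weyl_rels x d /\
  forall (B : algType K) (y e : 'I_n -> B), weyl_rels y e ->
    (exists f : {lrmorphism A -> B},
        forall i, f (x i) = y i /\ f (d i) = e i) /\
    (forall f g : {lrmorphism A -> B},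
        (forall i, f (x i) = g (x i) /\ f (d i) = g (d i)) ->
        forall a, f a = g a).

Definition fg_left_over_image (K : fieldType) (A : algType K)
    (phi : A -> A) : Prop :=
  exists s : seq A, forall b : A,
    exists c : 'I_(size s) -> A, b = \sum_(i < size s) phi (c i) * s`_i.

Definition fg_right_over_image (K : fieldType) (A : algType K)
    (phi : A -> A) : Prop :=
  exists s : seq A, forall b : A,
    exists c : 'I_(size s) -> A, b = \sum_(i < size s) s`_i * phi (c i).

(* Main.v *)
(** Let S = phi(A) with A finite as a left S-module, y = phi(g) for a generator g,
    and delta = [y, -]. As S is an Ore domain, every x in A has a minimal relation
    sum_(i <= e) s_i delta^i x = 0 with s_i in S, and for a left S-linear form
    h : A -> S the sequence b_m = h(delta^m x) obeys a recurrence with coefficients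
    s_i, on which bracketing with g lowers the degree. If the relation is regular,
    i.e. deg s_i - i <= deg s_e - e for all i, then deg b_m + m is bounded, so b_m
    vanishes for large m. If it is irregular and h kills delta^i x for i < e - 1 but
    not for i = e - 1, then b_m is not eventually zero, even after reduction modulo
    a suitable prime p; but delta^p = 0 in characteristic p, a contradiction (this is
    the mechanism of Katz's theorem that nilpotent p-curvature implies regular
    singularities). So all the delta are locally nilpotent on A. The centralizer of S
    is algebraic over K, hence equal to K, and a Taylor expansion along the
    generators of S gives A = S. Right modules are treated in the opposite
    algebra. *)

Require Import Defs.
From HB Require Import structures.
From mathcomp Require Import all_boot all_order all_algebra all_field.
From mathcomp Require Import ssrcomplements mpoly ring lra zify.
From Stdlib Require Import Classical ClassicalEpsilon.
Import Order.TTheory GRing.Theory Num.Theory.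
Local Open Scope ring_scope.
Set Implicit Arguments.
Unset Strict Implicit.
Unset Printing Implicit Defensive.

(** * A concrete Weyl algebra *)

(** In characteristic 0 it is no contradiction that b_m never becomes 0; only delta^p = 0 excludes
    it, hence the reduction modulo p. That identity holds because A_n(k) has rank at most p^(2n)
    over its central p-th powers, while the images under phi of the p^(2n) monomials with exponents
    below p are independent over the centre; so every element has a nonzero central multiple in
    their span, and delta^p kills them. Only finitely many data have to survive the reduction, among
    them the coordinates of 1 and of all a_j g on the generators a_i of A: they give coordinates in
    the chosen finitely generated ring to every element with coefficients there, which makes h
    compatible with reduction. The image S is never formed. As phi is injective, the source stands
    for S: a form A -> S becomes an additive map h with h(phi(s) b) = s h(b), and the degrees in the
    recurrence are those of the source, where bracketing with g is a partial derivative up to sign.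
    No division ring of fractions is built either: counting coefficients gives independence, maximal
    families and separating forms, at the price of nonzero multipliers t. *)

Section LinearExtension.
Context (m : nat) (R : nzRingType) (V : lmodType R).

Definition linext (F : 'X_{1..m} -> V) (p : {mpoly R[m]}) : V :=
  \sum_(k <- msupp p) p@_k *: F k.

Lemma linextE F p N : (msize p <= N)%N ->
  linext F p = \sum_(k : 'X_{1..m < N}) p@_k *: F k.
Proof.
move=> le_pN; set I : subFinType _ := 'X_{1..m < N}.
rewrite /linext (big_mksub I) ?msupp_uniq //=; first last.
  by move=> x /msize_mdeg_lt /leq_trans; apply.
rewrite big_rmcond //= => j /memN_msupp_eq0 ->.
by rewrite scale0r.
Qed.

Lemma linext_is_linear F : linear (linext F).
Proof.
move=> c p q; set N := maxn (msize (c *: p + q)) (maxn (msize p) (msize q)).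
rewrite !(@linextE _ _ N) ?leq_max ?leqnn ?orbT //.
rewrite scaler_sumr -big_split /=; apply: eq_bigr => k _.
by rewrite mcoeffD mcoeffZ scalerDl scalerA.
Qed.

HB.instance Definition _ F :=
  GRing.isLinear.Build R {mpoly R[m]} V _ (linext F) (linext_is_linear F).

Lemma linextX F k : linext F 'X_[k] = F k.
Proof. by rewrite /linext msuppX big_seq1 mcoeffX eqxx scale1r. Qed.

End LinearExtension.

Section WeylOperators.
Context (R : comNzRingType) (n : nat).
Local Notation T := {mpoly R[n + n]}.
Implicit Types (p q : T) (g h : 'I_(n + n)).

(* A polynomial in n + n variables is the normally ordered symbol of an element:
   the first n variables are the x_i, the last n the d_i.  [lop g] and [rop g]
   are left and right multiplication by the g-th generator. They commute, and 1
   generates everything under the [rop g], which is why [wmul] is associative. *)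
Definition lop g q : T :=
  match split g with
  | inl i => 'X_g * q
  | inr i => 'X_g * q + q^`M(lshift n i)
  end.

Definition rop g q : T :=
  match split g with
  | inl i => 'X_g * q + q^`M(rshift n i)
  | inr i => 'X_g * q
  end.

Lemma lop_is_linear g : linear (lop g).
Proof.
move=> c p q; rewrite /lop; case: split => i.
  by rewrite mulrDr scalerAr.
by rewrite mulrDr mderivD mderivZ -scalerAr scalerDr addrACA.
Qed.
HB.instance Definition _ g := GRing.isLinear.Build R T T _ (lop g) (lop_is_linear g).

Lemma rop_is_linear g : linear (rop g).
Proof.
move=> c p q; rewrite /rop; case: split => i; last by rewrite mulrDr scalerAr.
by rewrite mulrDr mderivD mderivZ -scalerAr scalerDr addrACA.
Qed.
HB.instance Definition _ g := GRing.isLinear.Build R T T _ (rop g) (rop_is_linear g).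

Lemma lop_lshift i q : lop (lshift n i) q = 'X_(lshift n i) * q.
Proof. by rewrite /lop (unsplitK (inl i)). Qed.
Lemma lop_rshift i q :
  lop (rshift n i) q = 'X_(rshift n i) * q + q^`M(lshift n i).
Proof. by rewrite /lop (unsplitK (inr i)). Qed.
Lemma rop_lshift i q :
  rop (lshift n i) q = 'X_(lshift n i) * q + q^`M(rshift n i).
Proof. by rewrite /rop (unsplitK (inl i)). Qed.
Lemma rop_rshift i q : rop (rshift n i) q = 'X_(rshift n i) * q.
Proof. by rewrite /rop (unsplitK (inr i)). Qed.

Lemma mderivXU g h : ('X_h : T)^`M(g) = (g == h)%:R.
Proof.
rewrite mderivX mnm1E eq_sym; case: eqP => [->|_]; last by rewrite scale0r.
rewrite scale1r; have -> : (U_(h) - U_(h))%MM = 0%MM.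
  by apply/mnmP => i; rewrite mnmBE subnn mnm0E.
by rewrite mpolyX0.
Qed.

Lemma ordP (P : 'I_(n + n) -> Prop) :
  (forall i, P (lshift n i)) -> (forall i, P (rshift n i)) -> forall g, P g.
Proof. by move=> Pl Pr g; rewrite -(splitK g); case: split => i /=. Qed.

Lemma lop_rop g h q : lop g (rop h q) = rop h (lop g q).
Proof.
elim/ordP: g => i; elim/ordP: h => j;
  rewrite ?lop_lshift ?lop_rshift ?rop_lshift ?rop_rshift.
- by rewrite mulrDr mderivM mderivXU eq_rlshift mul0r add0r mulrCA.
- by rewrite mulrCA.
- rewrite !mulrDr !mderivD !mderivM !mderivXU (inj_eq (@lshift_inj _ _)).
  rewrite (inj_eq (@rshift_inj _ _)) eq_sym (mderiv_comm (rshift n j)).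
  ring.
- by rewrite mulrDr mderivM mderivXU eq_lrshift mul0r add0r mulrCA.
Qed.

(** Left multiplication by a normally ordered monomial: the enumeration lists the x_i before the d_i
    and [foldr] applies its last entries first, so the d_i act before the x_i. *)
Definition lmono (k : 'X_{1..n + n}) q : T :=
  foldr (fun g => iter (k g) (lop g)) q (enum 'I_(n + n)).

Lemma lmono_closed (P : T -> T -> Prop) k p q :
  (forall g p q, P p q -> P (lop g p) (lop g q)) -> P p q -> P (lmono k p) (lmono k q).
Proof.
move=> HP; rewrite /lmono; elim: (enum _) => //= g s IH /IH.
by elim: (k g) => //= a IHa /IHa; apply: HP.
Qed.

Lemma lmono_is_linear k : linear (lmono k).
Proof.
move=> c p q; rewrite /lmono; elim: (enum _) => //= g s ->.
by elim: (k g) => //= a ->; rewrite linearP.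
Qed.
HB.instance Definition _ k := GRing.isLinear.Build R T T _ (lmono k) (lmono_is_linear k).

Lemma lmono_rop k h q : lmono k (rop h q) = rop h (lmono k q).
Proof.
apply: (@lmono_closed (fun p p' => p = rop h p') k (rop h q) q) => // g p p' ->.
exact: lop_rop.
Qed.

Lemma enum_ordD : enum 'I_(n + n) =
  map (lshift n) (enum 'I_n) ++ map (@rshift n n) (enum 'I_n).
Proof.
apply: (inj_map val_inj); rewrite val_enum_ord map_cat -!map_comp.
rewrite iotaD add0n; congr (_ ++ _).
  by rewrite -val_enum_ord enumT; apply: eq_map.
rewrite -[X in iota X _](addn0 n) iotaDl -val_enum_ord enumT -!map_comp.
exact: eq_map.
Qed.

(** Starting from 1, the d_i only produce polynomials in the d_i, on which the derivative in [lop]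
    vanishes; the x_i, applied afterwards, need no correction. *)
Lemma lmono1 k : lmono k 1 = 'X_[k].
Proof.
have itX g a (q : T) : iter a ( *%R 'X_g) q = 'X_[(U_(g) *+ a)%MM] * q.
  elim: a => [|a IH] /=; first by rewrite mulm0n mpolyX0 mul1r.
  by rewrite IH mulmS mpolyXD mulrA.
have foldX (s : seq 'I_(n + n)) (q : T) :
    foldr (fun g => iter (k g) ( *%R 'X_g)) q s =
    'X_[\big[mnm_add/0%MM]_(g <- s) (U_(g) *+ k g)%MM] * q.
  elim: s => [|g s IH] /=; first by rewrite big_nil mpolyX0 mul1r.
  by rewrite IH itX big_cons mpolyXD mulrA.
rewrite /lmono enum_ordD foldr_cat.
set r := foldr _ 1 _.
have rE s : let r := foldr (fun g => iter (k g) (lop g)) 1 (map (@rshift n n) s) in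
    r = 'X_[\big[mnm_add/0%MM]_(g <- map (@rshift n n) s) (U_(g) *+ k g)%MM] /\
    (forall i, r^`M(lshift n i) = 0).
  elim: s => [|j s] /=.
    by rewrite big_nil mpolyX0; split=> // i; rewrite mderivC.
  set r' := foldr _ _ _; case=> rE r0; rewrite big_cons mpolyXD.
  have step a : let r'' := iter a (lop (rshift n j)) r' in
     r'' = 'X_[(U_(rshift n j) *+ a)%MM] * r' /\ forall i, r''^`M(lshift n i) = 0.
    elim: a => [|a [IH1 IH2]] /=; first by rewrite mulm0n mpolyX0 mul1r.
    rewrite lop_rshift IH2 addr0; split.
      by rewrite IH1 mulmS mpolyXD mulrA.
    by move=> i; rewrite mderivM IH2 mderivXU eq_lrshift mul0r mulr0 addr0.
  by case: (step (k (rshift n j))) => -> H; split=> //; rewrite -rE.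
rewrite {}/r (rE (enum 'I_n)).1.
transitivity ('X_[\big[mnm_add/0%MM]_(g <- enum 'I_(n + n)) (U_(g) *+ k g)%MM] : T).
  rewrite enum_ordD big_cat mpolyXD -foldX /=.
  move: 'X_[_] => q; elim: (enum 'I_n) => //= i s ->.
  by elim: (k _) => //= a ->; rewrite lop_lshift.
by congr 'X_[_]; rewrite [RHS]multinomUE_id big_enum.
Qed.

(** The star product of normally ordered symbols. *)
Definition wmul p q : T := linext (fun k => lmono k q) p.

Lemma wmul_linr p : linear (wmul p).
Proof.
move=> c q q'; rewrite /wmul /linext scaler_sumr -big_split /=.
by apply: eq_bigr => k _; rewrite linearP scalerDr !scalerA mulrC.
Qed.

Lemma wmul_linl q : linear (wmul^~ q).
Proof. by move=> c p p'; rewrite /wmul linearP. Qed.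

HB.instance Definition _ p := GRing.isLinear.Build R T T _ (wmul p) (wmul_linr p).
Definition wmulr q p := wmul p q.
HB.instance Definition _ q := GRing.isLinear.Build R T T _ (wmulr q) (wmul_linl q).

Lemma wmul1 p : wmul p 1 = p.
Proof.
rewrite /wmul /linext [RHS]mpolyE; apply: eq_bigr => k _.
by rewrite lmono1.
Qed.

Lemma wmul_rop p h q : wmul p (rop h q) = rop h (wmul p q).
Proof.
rewrite /wmul /linext linear_sum; apply: eq_bigr => k _.
by rewrite lmono_rop linearZ_LR.
Qed.

Lemma mpolyX_ind (P : T -> Prop) :
  P 0 -> (forall c p q, P p -> P q -> P (c *: p + q)) ->
  (forall k, (forall k', (mdeg k' < mdeg k)%N -> P 'X_[k']) -> P 'X_[k]) ->
  forall p, P p.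
Proof.
move=> P0 Plin PX.
have PXk k : P 'X_[k].
  have [N le_kN] := ubnP (mdeg k); elim: N => // N IH in k le_kN *.
  by apply: PX => k' lt; apply: IH; apply: leq_trans lt _; rewrite -ltnS.
by elim/mpolyind => // c k p _ _; apply: Plin.
Qed.

Lemma mnm_predP (k : 'X_{1..n + n}) :
  k = 0%MM \/ exists g k', k = (U_(g) + k')%MM /\ (mdeg k' < mdeg k)%N.
Proof.
have [->|k0] := eqVneq k 0%MM; first by left.
right; have [g kg] : exists g, k g != 0%N.
  apply/existsP; apply: contraNT k0 => /existsPn H; apply/eqP/mnmP => i.
  by rewrite mnm0E; apply/eqP; move: (H i); rewrite negbK.
have E : k = (U_(g) + (k - U_(g)))%MM by rewrite addmC submK // lep1mP.
exists g, (k - U_(g))%MM; split => //.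
by rewrite [in X in (_ < X)%N]E mdegD mdeg1.
Qed.

(** Induction on the degree: a generator times a monomial is [lop] of that monomial up to a
    derivative of smaller degree. *)
Lemma lop_ind (P : T -> Prop) :
  P 1 -> (forall c p q, P p -> P q -> P (c *: p + q)) ->
  (forall g p, P p -> P (lop g p)) -> forall p, P p.
Proof.
move=> P1 Plin Pop.
have P0 : P 0 by have := Plin (-1) 1 1 P1 P1; rewrite scaleN1r addNr.
apply: mpolyX_ind => // k IH; case: (mnm_predP k) => [->|]; first by rewrite mpolyX0.
case=> g [k' [Ek lt]]; have := Pop g _ (IH _ lt).
rewrite {}Ek in IH *; elim/ordP: g IH => i IH; rewrite ?lop_lshift ?lop_rshift mpolyXD //.
set a := _ * _; rewrite mderivX => Pa.
rewrite -[a](addrK (((k' (lshift n i))%:R : R) *: 'X_[(k' - U_(lshift n i))%MM])).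
rewrite addrC -scaleNr; apply: Plin => //; apply: IH.
by rewrite mdegD mdeg1 add1n ltnS mdegB.
Qed.

Lemma rop_ind (P : T -> Prop) :
  P 1 -> (forall c p q, P p -> P q -> P (c *: p + q)) ->
  (forall g p, P p -> P (rop g p)) -> forall p, P p.
Proof.
move=> P1 Plin Pop.
have P0 : P 0 by have := Plin (-1) 1 1 P1 P1; rewrite scaleN1r addNr.
apply: mpolyX_ind => // k IH; case: (mnm_predP k) => [->|]; first by rewrite mpolyX0.
case=> g [k' [Ek lt]]; have := Pop g _ (IH _ lt).
rewrite {}Ek in IH *; elim/ordP: g IH => i IH; rewrite ?rop_lshift ?rop_rshift mpolyXD //.
set a := _ * _; rewrite mderivX => Pa.
rewrite -[a](addrK (((k' (rshift n i))%:R : R) *: 'X_[(k' - U_(rshift n i))%MM])).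
rewrite addrC -scaleNr; apply: Plin => //; apply: IH.
by rewrite mdegD mdeg1 add1n ltnS mdegB.
Qed.

Lemma wmulA : associative wmul.
Proof.
move=> p q r; elim/rop_ind: r => [|c r r' IH IH'|g r IH].
- by rewrite !wmul1.
- by rewrite (linearP (wmul q)) (linearP (wmul p)) (linearP (wmul (wmul p q))) /= -IH -IH'.
- by rewrite !wmul_rop IH.
Qed.

Lemma wmulX g q : wmul 'X_g q = lop g q.
Proof.
elim/rop_ind: q => [|c r r' IH IH'|h r IH].
- rewrite wmul1; elim/ordP: g => i; rewrite ?lop_lshift ?lop_rshift mulr1 //.
  by rewrite mderivC addr0.
- by rewrite (linearP (wmul _)) (linearP (lop g)) /= -IH -IH'.
- by rewrite wmul_rop IH lop_rop.
Qed.

Lemma wmul1l q : wmul 1 q = q.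
Proof.
elim/rop_ind: q => [|c r r' IH IH'|h r IH]; first by rewrite wmul1.
  by rewrite (linearP (wmul _)) /= IH IH'.
by rewrite wmul_rop IH.
Qed.

Lemma wmulXr g q : wmul q 'X_g = rop g q.
Proof.
rewrite -[RHS](congr1 (rop g) (wmul1 q)) -wmul_rop; congr wmul.
elim/ordP: g => i; rewrite ?rop_lshift ?rop_rshift mulr1 //.
by rewrite mderivC addr0.
Qed.

End WeylOperators.

(** An alias of the polynomial type that carries the noncommutative product; addition, scalars,
    support and degree remain those of the symbol. *)
Definition weyl (R : comNzRingType) (n : nat) := {mpoly R[n + n]}.

HB.instance Definition _ (R : comNzRingType) n :=
  GRing.Lmodule.copy (weyl R n) {mpoly R[n + n]}.

HB.instance Definition _ (R : comNzRingType) n :=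
  GRing.Zmodule_isNzRing.Build (weyl R n) (@wmulA R n) (@wmul1l R n) (@wmul1 R n)
    (fun p q r => linearD (wmulr r) p q) (fun p q r => linearD (wmul p) q r)
    (oner_neq0 {mpoly R[n + n]}).

HB.instance Definition _ (R : comNzRingType) n :=
  GRing.Lmodule_isLalgebra.Build R (weyl R n)
    (fun a p q => esym (linearZ_LR (wmulr q) a p)).

HB.instance Definition _ (R : comNzRingType) n :=
  GRing.Lalgebra_isAlgebra.Build R (weyl R n)
    (fun a p q => esym (linearZ_LR (wmul p) a q)).

Section WeylGenerators.
Context (R : comNzRingType) (n : nat).
Implicit Types (a b : weyl R n) (g h : 'I_(n + n)).

Definition wgen g : weyl R n := 'X_g.

(** Conjugation of variables and the sign of the symplectic form; they allow the x_i and the d_i to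
    be treated as one family of generators. *)
Definition wconj g : 'I_(n + n) :=
  match split g with inl i => rshift n i | inr i => lshift n i end.

Definition wsign (S : nzRingType) g : S :=
  match split g with inl _ => -1 | inr _ => 1 end.

Lemma wconj_lshift i : wconj (lshift n i) = rshift n i.
Proof. by rewrite /wconj (unsplitK (inl i)). Qed.
Lemma wconj_rshift i : wconj (rshift n i) = lshift n i.
Proof. by rewrite /wconj (unsplitK (inr i)). Qed.
Lemma wsign_lshift S i : wsign S (lshift n i) = -1.
Proof. by rewrite /wsign (unsplitK (inl i)). Qed.
Lemma wsign_rshift S i : wsign S (rshift n i) = 1.
Proof. by rewrite /wsign (unsplitK (inr i)). Qed.

Lemma wconjK : involutive wconj.
Proof.
by elim/ordP => i; rewrite ?(wconj_lshift, wconj_rshift) ?(wconj_lshift, wconj_rshift).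
Qed.

Lemma wsign_sqr (S : nzRingType) g : wsign S g * wsign S g = 1.
Proof.
by elim/ordP: g => i; rewrite ?(wsign_lshift, wsign_rshift) ?mulrNN mulr1.
Qed.

Lemma wgenM g a : wgen g * a = lop g a.
Proof. exact: wmulX. Qed.

Lemma wgenMr g a : a * wgen g = rop g a.
Proof. exact: wmulXr. Qed.

(* Bracketing with a generator is, up to sign, differentiation with respect to
   the conjugate generator. *)
Definition wderiv g a : weyl R n := mderiv g (a : {mpoly R[n + n]}).

Lemma wderiv_is_linear g : linear (wderiv g).
Proof. exact: mderiv_is_linear. Qed.
HB.instance Definition _ g :=
  GRing.isLinear.Build R (weyl R n) (weyl R n) _ (wderiv g) (wderiv_is_linear g).

Lemma wgen_comm g a : wgen g * a - a * wgen g = wsign R g *: wderiv (wconj g) a.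
Proof.
rewrite wgenM wgenMr /wderiv; elim/ordP: g => i.
  rewrite lop_lshift rop_lshift wsign_lshift wconj_lshift scaleN1r.
  by rewrite opprD addrA subrr add0r.
rewrite lop_rshift rop_rshift wsign_rshift wconj_rshift scale1r.
by rewrite addrAC subrr add0r.
Qed.

Lemma weyl_ind (P : weyl R n -> Prop) :
  P 1 -> (forall c a b, P a -> P b -> P (c *: a + b)) ->
  (forall g a, P a -> P (wgen g * a)) -> forall a, P a.
Proof.
move=> P1 Plin Pgen; apply: lop_ind => //= g a Pa.
by rewrite -wgenM; apply: Pgen.
Qed.

End WeylGenerators.

Arguments wgen {R n} g.

(** * Universal property and base change *)

Section WeylUniversal.
Context (R : comNzRingType) (n : nat).

Definition weyl_family (B : nzRingType) (z : 'I_(n + n) -> B) :=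
  forall g h, z g * z h - z h * z g = wsign B g * (wconj g == h)%:R.

Lemma wgen_family : weyl_family (@wgen R n).
Proof.
move=> g h; rewrite wgen_comm /wderiv mderivXU; case: eqP => _.
  rewrite mulr1 /wsign; case: split => _; first by rewrite scaleN1r.
  by rewrite scale1r.
by rewrite mulr0 scaler0.
Qed.

Context (B : algType R) (z : 'I_(n + n) -> B).

Definition weyl_eval (a : weyl R n) : B := linext (mmap1 z) a.

Lemma weyl_eval_is_linear : linear weyl_eval.
Proof. exact: linext_is_linear. Qed.
HB.instance Definition _ :=
  GRing.isLinear.Build R (weyl R n) B _ weyl_eval weyl_eval_is_linear.

Lemma mmap1_commM m (c : 'I_m -> B) k l :
  (forall i j, c i * c j = c j * c i) ->
  mmap1 c (k + l)%MM = mmap1 c k * mmap1 c l.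
Proof.
move=> cC; rewrite /mmap1 -prodrM_comm => [|i j _ _].
  by apply: eq_bigr => i _; rewrite mnmDE exprD.
by apply/commrX/commr_sym/commrX/cC.
Qed.

Definition lpart (k : 'X_{1..n + n}) : 'X_{1..n} := [multinom k (lshift n i) | i < n].
Definition rpart (k : 'X_{1..n + n}) : 'X_{1..n} := [multinom k (rshift n i) | i < n].

Lemma mmap1_split (k : 'X_{1..n + n}) :
  mmap1 z k = mmap1 (z \o lshift n) (lpart k) * mmap1 (z \o @rshift n n) (rpart k).
Proof.
rewrite /mmap1 big_split_ord /=.
by congr (_ * _); apply: eq_bigr => i _; rewrite mnmE.
Qed.

Hypothesis zW : weyl_family z.

Let xC i j : (z \o lshift n) i * (z \o lshift n) j = (z \o lshift n) j * (z \o lshift n) i.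
Proof.
by apply/eqP; rewrite -subr_eq0 /= zW wconj_lshift eq_rlshift mulr0.
Qed.
Let dC i j : (z \o @rshift n n) i * (z \o @rshift n n) j =
  (z \o @rshift n n) j * (z \o @rshift n n) i.
Proof.
by apply/eqP; rewrite -subr_eq0 /= zW wconj_rshift eq_lrshift mulr0.
Qed.

Lemma mmap1_comm_r i (k : 'X_{1..n}) :
  z (rshift n i) * mmap1 (z \o lshift n) k =
  mmap1 (z \o lshift n) k * z (rshift n i) +
    (k i)%:R *: mmap1 (z \o lshift n) (k - U_(i))%MM.
Proof.
have [N le_kN] := ubnP (mdeg k); elim: N => // N IH in k le_kN *.
have [->|k0] := eqVneq k 0%MM.
  by rewrite mnm0E mmap11 scale0r addr0 mulr1 mul1r.
have [j kj] : exists j, k j != 0%N.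
  apply/existsP; apply: contraNT k0 => /existsPn H; apply/eqP/mnmP => j.
  by rewrite mnm0E; apply/eqP; move: (H j); rewrite negbK.
have E : k = (U_(j) + (k - U_(j)))%MM by rewrite addmC submK // lep1mP.
set l := (k - U_(j))%MM in E.
have lt_lN : (mdeg l < N)%N.
  by rewrite -ltnS; apply: leq_trans le_kN; rewrite [in X in (_ < X)%N]E mdegD mdeg1.
clearbody l; have := zW (rshift n i) (lshift n j); rewrite wsign_rshift mul1r wconj_rshift.
rewrite (inj_eq (@lshift_inj _ _)) => /eqP; rewrite subr_eq => /eqP zz.
rewrite [in LHS]E mmap1_commM // mmap1U mulrA /= zz mulrDl -!mulrA IH // mulrDr.
rewrite [in mmap1 _ k * _]E mmap1_commM // mmap1U /= !mulrA.
rewrite addrCA; congr (_ + _).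
rewrite -scalerAr E mnmDE mnm1E eq_sym [in RHS]scaler_nat mulrnDr.
rewrite -!scaler_nat; case: (eqVneq i j) => [<-|ij].
  rewrite !scale1r mul1r (addmC U_(i)%MM l) addmK; congr (_ + _).
  (* The subtraction in [l - U_(i)] is truncated when [l i] is 0, but then its coefficient is 0. *)
  have [->|li] := eqVneq (l i) 0%N; first by rewrite !scale0r.
  congr (_ *: _); rewrite -[z _]/((z \o lshift n) i) -[(z \o _) i](mmap1U _ i).
  by rewrite -mmap1_commM // addmC submK // lep1mP.
rewrite !scale0r mul0r !add0r.
have [->|li] := eqVneq (l i) 0%N; first by rewrite !scale0r.
congr (_ *: _); rewrite -[z _]/((z \o lshift n) j) -[(z \o _) j](mmap1U _ j).
rewrite -mmap1_commM //; congr mmap1.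
apply/mnmP => h; rewrite !(mnmDE, mnmBE) !mnm1E.
by case: (eqVneq i h) => [<-|_]; [rewrite addnBA // lt0n | rewrite !subn0].
Qed.

Lemma lpartD k l : lpart (k + l) = (lpart k + lpart l)%MM.
Proof. by apply/mnmP => i; rewrite !mnmE. Qed.
Lemma rpartD k l : rpart (k + l) = (rpart k + rpart l)%MM.
Proof. by apply/mnmP => i; rewrite !mnmE. Qed.
Lemma lpartU i : lpart U_(lshift n i) = U_(i)%MM.
Proof. by apply/mnmP => j; rewrite !mnmE (inj_eq (@lshift_inj _ _)). Qed.
Lemma rpartU i : rpart U_(rshift n i) = U_(i)%MM.
Proof. by apply/mnmP => j; rewrite !mnmE (inj_eq (@rshift_inj _ _)). Qed.
Lemma lpartU0 i : lpart U_(rshift n i) = 0%MM.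
Proof. by apply/mnmP => j; rewrite !mnmE eq_rlshift. Qed.
Lemma rpartU0 i : rpart U_(lshift n i) = 0%MM.
Proof. by apply/mnmP => j; rewrite !mnmE eq_lrshift. Qed.
Lemma lpartB k i : lpart (k - U_(lshift n i)) = (lpart k - U_(i))%MM.
Proof. by apply/mnmP => j; rewrite !mnmE (inj_eq (@lshift_inj _ _)). Qed.
Lemma rpartB k i : rpart (k - U_(lshift n i)) = rpart k.
Proof. by apply/mnmP => j; rewrite !mnmE eq_lrshift subn0. Qed.

Lemma weyl_evalX k : weyl_eval 'X_[k] = mmap1 z k.
Proof. exact: linextX. Qed.

Lemma weyl_eval_lop g a : weyl_eval (lop g a) = z g * weyl_eval a.
Proof.
rewrite [a : {mpoly _[_]}]mpolyE !linear_sum mulr_sumr; apply: eq_bigr => k _.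
rewrite !linearZ_LR /= -scalerAr weyl_evalX; congr (_ *: _).
elim/ordP: g => i.
  rewrite lop_lshift -mpolyXD weyl_evalX !mmap1_split lpartD rpartD lpartU rpartU0.
  by rewrite mmap1_commM // mmap1U add0m -mulrA.
rewrite lop_rshift linearD -mpolyXD mderivX linearZ_LR /= !weyl_evalX !mmap1_split.
rewrite mulrA mmap1_comm_r mulrDl -mulrA lpartD rpartD lpartU0 rpartU add0m.
rewrite mmap1_commM // mmap1U lpartB rpartB -scalerAl mnmE.
by [].
Qed.

Lemma weyl_eval1 : weyl_eval 1 = 1.
Proof. by rewrite -(mmap11 z) -weyl_evalX mpolyX0. Qed.

Lemma weyl_evalM : {morph weyl_eval : a b / a * b}.
Proof.
move=> a b; elim/weyl_ind: a => [|c a a' IH IH'|g a IH].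
- by rewrite mul1r weyl_eval1 mul1r.
- by rewrite mulrDl -scalerAl !linearP /= IH IH' mulrDl scalerAl.
- by rewrite -mulrA !wgenM !weyl_eval_lop IH mulrA.
Qed.

Lemma weyl_eval_gen g : weyl_eval (wgen g) = z g.
Proof. by rewrite weyl_evalX mmap1U. Qed.

End WeylUniversal.

Lemma weyl_hom_ex (R : comNzRingType) n (B : algType R) (z : 'I_(n + n) -> B) :
  weyl_family z ->
  exists f : {lrmorphism weyl R n -> B}, forall g, f (wgen g) = z g.
Proof.
move=> zW.
pose M := GRing.isMonoidMorphism.Build (weyl R n) B (weyl_eval z)
  (conj (weyl_eval1 z) (weyl_evalM zW)).
pose f : {lrmorphism weyl R n -> B} := HB.pack (weyl_eval z) M
  (GRing.isLinear.Build R (weyl R n) B _ (weyl_eval z) (weyl_eval_is_linear z)).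
by exists f => g; apply: weyl_eval_gen.
Qed.

Lemma weyl_hom_eq (R : comNzRingType) n (B : algType R)
    (f f' : {lrmorphism weyl R n -> B}) :
  (forall g, f (wgen g) = f' (wgen g)) -> f =1 f'.
Proof.
move=> ff'; elim/weyl_ind => [|c a b IH IH'|g a IH]; first by rewrite !rmorph1.
  by rewrite !linearP /= IH IH'.
by rewrite !rmorphM /= ff' IH.
Qed.

Lemma lrmorph_weyl_family (R : comNzRingType) n (B : algType R)
   (f : {lrmorphism weyl R n -> B}) : weyl_family (fun g => f (wgen g)).
Proof.
move=> g h; rewrite -!rmorphM -rmorphB wgen_family rmorphM rmorph_nat; congr (_ * _).
by rewrite /wsign; case: split => _; rewrite ?rmorphN rmorph1.
Qed.

Section WeylMap.
Context (R S : comNzRingType) (n : nat) (f : {rmorphism R -> S}).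

Definition wmap (a : weyl R n) : weyl S n := map_mpoly f a.

Lemma wmap_is_additive : additive wmap.
Proof. exact: map_mpoly_is_additive. Qed.
HB.instance Definition _ := GRing.isZmodMorphism.Build (weyl R n) (weyl S n) wmap wmap_is_additive.

Lemma mcoeff_wmap k a : (wmap a)@_k = f a@_k.
Proof. exact: mcoeff_map_mpoly. Qed.

Lemma wmapX k : wmap 'X_[k] = 'X_[k].
Proof. exact: map_mpolyX. Qed.

Lemma wmapZ c a : wmap (c *: a) = f c *: wmap a.
Proof. exact: map_mpolyZ. Qed.

Lemma map_mderiv g (a : {mpoly R[n + n]}) :
  map_mpoly f a^`M(g) = (map_mpoly f a)^`M(g).
Proof.
by apply/mpolyP => k; rewrite mcoeff_map_mpoly !mcoeff_deriv mcoeff_map_mpoly; exact: raddfMn.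
Qed.

Lemma wmap_gen g a : wmap (wgen g * a) = wgen g * wmap a.
Proof.
rewrite !wgenM /wmap; elim/ordP: g => i.
  by rewrite !lop_lshift rmorphM /= map_mpolyX.
by rewrite !lop_rshift rmorphD rmorphM /= map_mpolyX map_mderiv.
Qed.

Lemma wmap1 : wmap 1 = 1.
Proof. exact: (rmorph1 (map_mpoly f)). Qed.

Lemma wmapM : {morph wmap : a b / a * b}.
Proof.
move=> a b; elim/weyl_ind: a => [|c a a' IH IH'|g a IH].
- by rewrite wmap1 !mul1r.
- by rewrite mulrDl -scalerAl !raddfD /= !wmapZ IH IH' mulrDl scalerAl.
- by rewrite -mulrA !wmap_gen IH mulrA.
Qed.
HB.instance Definition _ :=
  GRing.isMonoidMorphism.Build (weyl R n) (weyl S n) wmap (conj wmap1 wmapM).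

End WeylMap.

(** * Degree *)

Section WeylDegree.
Context (R : comNzRingType) (n : nat).
Local Notation T := {mpoly R[n + n]}.
Implicit Types (a b : weyl R n) (g : 'I_(n + n)).

Lemma msize_mderiv m (p : {mpoly R[m]}) i : (msize p^`M(i) <= (msize p).-1)%N.
Proof.
rewrite [msize p^`M(i)]msizeE; apply/bigmax_leqP_seq => k + _.
rewrite mcoeff_msupp mcoeff_deriv => nz.
have : (k + U_(i))%MM \in msupp p.
  by rewrite mcoeff_msupp; apply: contraNneq nz => ->; rewrite mul0rn.
by move/msize_mdeg_lt; rewrite mdegD mdeg1 addn1; case: (msize p).
Qed.

Lemma msize_mul_le m (p q : {mpoly R[m]}) : (msize (p * q) <= (msize p + msize q).-1)%N.
Proof.
have [->|pq0] := eqVneq (p * q) 0; first by rewrite mmeasure0.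
have p0 : p != 0 by apply: contraNneq pq0 => ->; rewrite mul0r.
have q0 : q != 0 by apply: contraNneq pq0 => ->; rewrite mulr0.
rewrite -(mlead_deg pq0) -(mlead_deg p0) -(mlead_deg q0) addSn addnS /= ltnS.
by rewrite -mdegD; apply: lemc_mdeg; apply: mleadM_le.
Qed.

(** The derivative terms of [lop] lose a degree, so up to lower degree a monomial acts by
    commutative multiplication. The second bound in [D] is there to control these terms. *)
Lemma msize_lmono_sub k (q : T) :
  (msize (lmono k q - 'X_[k] * q) <= (mdeg k + msize q).-1)%N.
Proof.
pose D (p w : T) d := (msize (p - w * q) <= (d + msize q).-1)%N /\
  (msize p <= d + msize q)%N.
have step g p w d : D p w d -> D (lop g p) ('X_g * w) d.+1.
  case=> sz1 sz2.
  have E : exists2 r : T, (msize r <= (d + msize q).-1)%N &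
     lop g p = 'X_g * p + r.
    elim/ordP: g => i; rewrite ?lop_lshift ?lop_rshift.
      by exists 0; [rewrite mmeasure0 | rewrite addr0].
    by eexists; last reflexivity; apply: leq_trans (msize_mderiv _ _) _; lia.
  case: E => r szr ->.
  have szX (r' : T) : (msize ('X_g * r') <= (msize r').+1)%N.
    apply: leq_trans (msize_mul_le _ _) _.
    by rewrite msizeX mdeg1.
  split; last first.
    apply: leq_trans (msizeD_le _ _) _; rewrite geq_max; apply/andP; split.
      by apply: leq_trans (szX _) _; rewrite addSn ltnS.
    by apply: leq_trans szr _; lia.
  rewrite addrAC -mulrA -mulrBr.
  apply: leq_trans (msizeD_le _ _) _; rewrite geq_max; apply/andP; split; last first.
    by apply: leq_trans szr _; lia.
  have [->|nz] := eqVneq (p - w * q) 0; first by rewrite mulr0 mmeasure0.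
  apply: leq_trans (szX _) _.
  have pos : (0 < msize (p - w * q))%N by rewrite lt0n mmeasure_poly_eq0.
  apply: (leq_ltn_trans sz1); rewrite addSn /= ltn_predL.
  by apply: leq_trans pos _; apply: leq_trans sz1 _; apply: leq_pred.
have iterD g (a : nat) (p w : T) d : D p w d ->
    D (iter a (lop g) p) ('X_[(U_(g) *+ a)%MM] * w) (a + d)%N.
  move=> H; elim: a => [|a IH] /=; first by rewrite mulm0n mpolyX0 mul1r.
  by rewrite mulmS mpolyXD -mulrA addSn; apply: step.
have foldD (s : seq 'I_(n + n)) :
    D (foldr (fun g => iter (k g) (lop g)) q s)
      'X_[(\sum_(g <- s) U_(g) *+ k g)%MM] (\sum_(g <- s) k g)%N.
  elim: s => [|g s IH] /=.
    by rewrite !big_nil mpolyX0 /D mul1r subrr mmeasure0.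
  by rewrite !big_cons mpolyXD; apply: iterD.
case: (foldD (enum 'I_(n + n))) => + _.
rewrite -[foldr _ _ _]/(lmono k q) !big_enum /= -multinomUE_id -mdegE.
by [].
Qed.

Lemma msize_wmul_sub a b :
  (msize (wmul a b - (a : T) * b) <= (msize a + msize b).-2)%N.
Proof.
rewrite [X in _ - X * _]mpolyE mulr_suml /wmul /linext -sumrB.
apply: leq_trans (msize_sum _ _ _) _; apply/bigmax_leqP_seq => k kin _.
rewrite -scalerAl -scalerBr; apply: leq_trans (msizeZ_le _ _) _.
apply: leq_trans (msize_lmono_sub _ _) _.
by have := msize_mdeg_lt kin; lia.
Qed.

(* One plus the total degree, and 0 for the zero element. *)
Definition wsize a : nat := @mmeasure (n + n) R mdeg a.
Arguments wsize a%_R.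

Lemma wsize_eq0 a : (wsize a == 0%N) = (a == 0).
Proof. exact: mmeasure_poly_eq0. Qed.

Lemma wsize_gt0 a : (0 < wsize a)%N = (a != 0).
Proof. by rewrite lt0n wsize_eq0. Qed.

Lemma wsize0 : wsize 0 = 0%N.
Proof. by apply/eqP; rewrite wsize_eq0. Qed.

Lemma wsizeD_le a b : (wsize (a + b) <= maxn (wsize a) (wsize b))%N.
Proof. exact: msizeD_le. Qed.

Lemma wsizeN a : wsize (- a) = wsize a.
Proof. exact: mmeasureN. Qed.

Lemma wsize_sum_lt (I : Type) (r : seq I) (P : pred I) (F : I -> weyl R n) N :
  (0 < N)%N -> (forall i, P i -> (wsize (F i) < N)%N) ->
  (wsize (\sum_(i <- r | P i) F i) < N)%N.
Proof.
move=> N0 HF; elim/big_ind: _ => //; first by rewrite wsize0.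
by move=> a b ha hb; apply: leq_ltn_trans (wsizeD_le _ _) _; rewrite gtn_max ha.
Qed.

Lemma wsizeMn a k : (wsize (a *+ k) <= wsize a)%N.
Proof. rewrite -scaler_nat; exact: msizeZ_le. Qed.

Lemma wsize_comm g a : (wsize (wgen g * a - a * wgen g) <= (wsize a).-1)%N.
Proof.
rewrite wgen_comm; apply: leq_trans (msizeZ_le _ _) _; exact: msize_mderiv.
Qed.

End WeylDegree.

Arguments wsize {R n} a%_R.

Section WeylDomain.
Context (R : idomainType) (n : nat).
Implicit Types (a b : weyl R n).

(** The associated graded ring is a polynomial ring over a domain: by [msize_wmul_sub] the
    correction cannot reach the leading monomial of the commutative product. *)
Lemma wsizeM a b : a != 0 -> b != 0 -> wsize (a * b) = (wsize a + wsize b).-1.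
Proof.
move=> a0 b0; have := wsize_gt0 a; have := wsize_gt0 b; rewrite a0 b0 /wsize => sb sa.
rewrite -[a * b]/(wmul a b) -[wmul a b](subrK ((a : {mpoly _[_]}) * b)).
have sz := msizeM a0 b0; have lt := msize_wmul_sub a b.
move: sz lt sa sb; move: (mmeasure _ a) (mmeasure _ b) => u v.
set p := _ - _; set q := (a : {mpoly _[_]}) * b => sz lt sa sb.
have q0 : q != 0 by rewrite -(mmeasure_poly_eq0 mdeg) sz; lia.
rewrite addrC -sz; apply/eqP; rewrite eqn_leq; apply/andP; split.
  apply: leq_trans (msizeD_le _ _) _; rewrite geq_max leqnn /= sz.
  by apply: leq_trans lt _; lia.
rewrite -(mlead_deg q0) /=; apply: msize_mdeg_lt.
have := mlead_supp q0; rewrite !mcoeff_msupp mcoeffD => nz.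
suff -> : p@_(mlead q) = 0 by rewrite addr0.
apply/eqP; rewrite mcoeff_eq0; apply: msize_mdeg_ge.
apply: (leq_trans lt); rewrite -ltnS (mlead_deg q0) sz; lia.
Qed.

Lemma wmul_eq0 a b : (a * b == 0) = (a == 0) || (b == 0).
Proof.
have [->|a0] := eqVneq a 0; first by rewrite mul0r eqxx.
have [->|b0] := eqVneq b 0; first by rewrite mulr0 eqxx.
apply/negbTE; rewrite -wsize_gt0 wsizeM //.
by move: a0 b0; rewrite -!wsize_gt0; lia.
Qed.

End WeylDomain.

(** * Dimension counts and the Ore conditions *)

Section Boxes.
Context (R : comNzRingType) (m : nat).
Implicit Types (p q : {mpoly R[m]}) (u v : 'I_m -> nat).

(** Boxes of exponents replace total degrees, since a box of constant bound N has exactly (N + 1)^m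
    monomials and the bounds add under [wmul]. *)
Definition bounded u p := forall k, k \in msupp p -> forall g, (k g <= u g)%N.

Lemma bounded_le u v p : (forall g, (u g <= v g)%N) -> bounded u p -> bounded v p.
Proof. by move=> uv up k kp g; apply: leq_trans (up k kp g) (uv g). Qed.

Lemma boundedD u p q : bounded u p -> bounded u q -> bounded u (p + q).
Proof.
move=> up uq k /msuppD_le; rewrite mem_cat => /orP[] kin g; [exact: up | exact: uq].
Qed.

Lemma boundedZ u c p : bounded u p -> bounded u (c *: p).
Proof.
move=> up k; rewrite mcoeff_msupp mcoeffZ => nz; apply: up.
by rewrite mcoeff_msupp; apply: contraNneq nz => ->; rewrite mulr0.
Qed.

Lemma bounded0 u : bounded u 0.
Proof. by move=> k; rewrite msupp0. Qed.

Lemma bounded_sum u (I : Type) (r : seq I) (P : pred I) (F : I -> {mpoly R[m]}) :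
  (forall i, P i -> bounded u (F i)) -> bounded u (\sum_(i <- r | P i) F i).
Proof.
move=> HF; elim/big_ind: _ => //; [exact: bounded0 | exact: boundedD].
Qed.

Lemma boundedX u (k : 'X_{1..m}) : (forall g, (k g <= u g)%N) -> bounded u 'X_[k].
Proof. by move=> ku l; rewrite msuppX inE => /eqP->. Qed.

Lemma bounded_msize p : bounded (fun=> msize p) p.
Proof.
move=> k /msize_mdeg_lt lt g; apply: leq_trans (ltnW lt).
by rewrite mdegE (bigD1 g) //= leq_addr.
Qed.

Lemma bounded_mulXU u g p : bounded u p ->
  bounded (fun h => (u h + (g == h))%N) ('X_g * p).
Proof.
move=> up k; rewrite mulrC (perm_mem (msuppMX _ _)) => /mapP[l lp ->] h.
by rewrite mnmDE mnm1E addnC leq_add2r; apply: up.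
Qed.

Lemma bounded_deriv u g p : bounded u p -> bounded u p^`M(g).
Proof.
move=> up k; rewrite mcoeff_msupp mcoeff_deriv => nz h.
have : (k + U_(g))%MM \in msupp p.
  by rewrite mcoeff_msupp; apply: contraNneq nz => ->; rewrite mul0rn.
by move/up/(_ h); rewrite mnmDE; apply: leq_trans; apply: leq_addr.
Qed.

End Boxes.

Section WeylBoxes.
Context (R : comNzRingType) (n : nat).
Implicit Types (a b : weyl R n).

Lemma bounded_lop u g (p : {mpoly R[n + n]}) : bounded u p ->
  bounded (fun h => (u h + (g == h))%N) (lop g p).
Proof.
elim/ordP: g => i up; rewrite ?lop_lshift ?lop_rshift; first exact: bounded_mulXU.
apply: boundedD; first exact: bounded_mulXU.
by apply: bounded_deriv; apply: bounded_le up => h; apply: leq_addr.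
Qed.

Lemma bounded_lmono u (k : 'X_{1..n + n}) (p : {mpoly R[n + n]}) : bounded u p ->
  bounded (fun h => (k h + u h)%N) (lmono k p).
Proof.
move=> up.
have it (a : nat) g (q : {mpoly R[n + n]}) v : bounded v q ->
    bounded (fun h => (v h + a * (g == h))%N) (iter a (lop g) q).
  move=> vq; elim: a => [|a IH] /=; first by apply: bounded_le vq => h; lia.
  apply: (bounded_le _ (bounded_lop IH)) => h; lia.
have fold s : bounded (fun h => (u h + count_mem h s * k h)%N)
    (foldr (fun g => iter (k g) (lop g)) p s).
  elim: s => [|g s IH] /=; first by apply: bounded_le up => h; lia.
  apply: bounded_le (it (k g) g _ _ IH) => h.
  rewrite mulnDl; case: eqP => [->|_]; last by rewrite muln0 mul0n addn0 add0n.
  by rewrite muln1 mul1n -addnA leq_add2l addnC.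
apply: bounded_le (fold _) => h.
by rewrite count_uniq_mem ?enum_uniq // mem_enum /=; lia.
Qed.

Lemma bounded_wmul u v a b : bounded u a -> bounded v b ->
  bounded (fun h => (u h + v h)%N) (a * b).
Proof.
move=> ua vb; rewrite -[a * b]/(wmul a b) /wmul /linext big_seq.
apply: bounded_sum => k kin; apply: boundedZ.
by apply: bounded_le (bounded_lmono (k := k) vb) => h; rewrite leq_add2r; apply: ua.
Qed.

End WeylBoxes.

Section BoxDependence.
Context (F : fieldType) (m : nat).

Let mono N (e : {ffun 'I_m -> 'I_N}) : 'X_{1..m} := [multinom (e i : nat) | i < m].

Lemma bounded_coef_eq0 N (p : {mpoly F[m]}) :
  bounded (fun=> N) p -> (forall e : {ffun 'I_m -> 'I_N.+1}, p@_(mono e) = 0) -> p = 0.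
Proof.
move=> bp p0; apply/mpolyP => k; rewrite mcoeff0.
case: (boolP (k \in msupp p)) => [kp|/memN_msupp_eq0 //].
rewrite -(p0 [ffun i => inord (k i)]); congr (p@_ _); apply/mnmP => i.
by rewrite mnmE ffunE inordK // ltnS; apply: bp.
Qed.

(** The unknowns are the coefficients of the [s i] in a box of bound N, the equations are the
    coefficients of the sums in a box of bound M; with more unknowns than equations the matrix has a
    nonzero kernel vector. *)
Lemma box_dependence (I J : finType) (T : I -> J -> {mpoly F[m]} -> {mpoly F[m]}) N M :
  (forall i j, linear (T i j)) ->
  (forall i j p, bounded (fun=> N) p -> bounded (fun=> M) (T i j p)) ->
  (#|J| * M.+1 ^ m < #|I| * N.+1 ^ m)%N ->
  exists s : I -> {mpoly F[m]}, (exists i, s i != 0) /\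
    forall j, \sum_i T i j (s i) = 0.
Proof.
move=> Tlin Tbnd card.
pose X := (I * {ffun 'I_m -> 'I_N.+1})%type; pose Y := (J * {ffun 'I_m -> 'I_M.+1})%type.
have cX : #|{: X}| = (#|I| * N.+1 ^ m)%N by rewrite card_prod card_ffun !card_ord.
have cY : #|{: Y}| = (#|J| * M.+1 ^ m)%N by rewrite card_prod card_ffun !card_ord.
pose A : 'M[F]_(#|{: X}|, #|{: Y}|) := \matrix_(x, y)
   (T (enum_val x).1 (enum_val y).1 'X_[mono (enum_val x).2])@_(mono (enum_val y).2).
have : kermx A != 0.
  rewrite kermx_eq0 /row_free; apply: contraL card => /eqP rk.
  by rewrite -leqNgt -cX -cY -rk rank_leq_col.
case/rowV0Pn => w /sub_kermxP wA w0.
pose s i : {mpoly F[m]} := \sum_(e : {ffun 'I_m -> 'I_N.+1}) w 0 (enum_rank ((i, e) : X)) *: 'X_[mono e].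
have sE i e : (s i)@_(mono e) = w 0 (enum_rank ((i, e) : X)).
  rewrite raddf_sum (bigD1 e) //= mcoeffZ mcoeffX eqxx mulr1 big1 ?addr0 // => e' ne.
  rewrite mcoeffZ mcoeffX (_ : _ == _ = false) ?mulr0 //.
  apply: contraNF ne => /eqP/mnmP H; apply/eqP/ffunP => i'.
  by apply: val_inj; move: (H i'); rewrite !mnmE.
exists s; split.
  have [x wx] : exists x, w 0 x != 0 by apply/rV0Pn.
  exists (enum_val x).1; apply: contraNneq wx => s0.
  have := sE (enum_val x).1 (enum_val x).2; rewrite s0 mcoeff0 => /esym/eqP.
  by rewrite -surjective_pairing enum_valK.
move=> j; apply: (@bounded_coef_eq0 M).
  apply: bounded_sum => i _; apply: Tbnd; apply: bounded_sum => e _; apply: boundedZ.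
  by apply: boundedX => g; rewrite mnmE -ltnS.
move=> e'; have := congr1 (fun z : 'rV_ _ => z 0 (enum_rank ((j, e') : Y))) wA.
rewrite !mxE => <-; rewrite raddf_sum /=.
pose G i e := w 0 (enum_rank ((i, e) : X)) * A (enum_rank ((i, e) : X)) (enum_rank ((j, e') : Y)).
transitivity (\sum_i \sum_e G i e).
  apply: eq_bigr => i _.
  pose TL : {linear {mpoly F[m]} -> {mpoly F[m]}} :=
    HB.pack (T i j) (GRing.isLinear.Build F {mpoly F[m]} {mpoly F[m]} _ (T i j) (Tlin i j)).
  rewrite -[T i j]/(TL : _ -> _) linear_sum raddf_sum /=; apply: eq_bigr => e _.
  by rewrite -[T i j]/(TL : _ -> _) linearZ_LR mcoeffZ /G /A mxE !enum_rankK.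
rewrite pair_bigA (reindex enum_rank) /=; last first.
  by exists enum_val => x _; rewrite ?enum_rankK ?enum_valK.
by apply: eq_bigr => -[i e] _.
Qed.

End BoxDependence.

Lemma box_growth (m r D : nat) : exists N, (r * (N + D).+1 ^ m < r.+1 * N.+1 ^ m)%N.
Proof.
(* This is (1 + 1/t)^m <= 1 + 3^m/t; the base 3 is a crude choice for which the induction closes. *)
have pow t : (0 < t)%N -> (t * t.+1 ^ m <= t ^ m * (t + 3 ^ m))%N.
  move=> t0; elim: m => [|k IH]; first by rewrite !expn0; lia.
  rewrite !expnS mulnCA; apply: leq_trans (leq_mul (leqnn t.+1) IH) _.
  rewrite mulnCA -mulnA [in X in (_ <= X)%N]mulnCA leq_mul2l; apply/orP; right.
  have := expn_gt0 3 k; move: (3 ^ k)%N => c /=; nia.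
(* This [t] satisfies r (t + 3^m) < (r + 1) t. With N + 1 = t E the larger side N + D + 1 is at most
   (t + 1) E, and the factor E^m cancels. *)
pose t := (r * 3 ^ m).+1; pose E := D.+1.
have key : (r * t.+1 ^ m < r.+1 * t ^ m)%N.
  have t0 : (0 < t)%N by [].
  rewrite -(ltn_pmul2l t0) mulnCA.
  apply: leq_ltn_trans (leq_mul (leqnn r) (pow t t0)) _.
  have tm : (0 < t ^ m)%N by rewrite expn_gt0 t0.
  rewrite mulnCA [in X in (_ < X)%N]mulnCA mulnC [in X in (_ < X)%N]mulnA [in X in (_ < X)%N]mulnC.
  rewrite [in X in (X < _)%N]mulnC ltn_pmul2l // /t; lia.
exists (t * E).-1; rewrite [in X in (_ < X)%N]prednK //.
apply: (@leq_ltn_trans (r * (t.+1 * E) ^ m)).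
  rewrite leq_mul2l; apply/orP; right; case: (posnP m) => [->|m0]; first by rewrite !expn0.
  rewrite leq_exp2r // mulSn; have : (0 < t * E)%N by [].
  by move: (t * E)%N => c; rewrite /E; lia.
by rewrite !expnMn !mulnA ltn_pmul2r // expn_gt0.
Qed.

(** * Linear algebra over an Ore domain *)

Section OreConditions.
Context (K : fieldType) (n : nat).
Local Notation D := (weyl K n).

Lemma bounded_family (I : finType) (F : I -> D) :
  exists N, forall i, bounded (fun=> N) (F i).
Proof.
exists (\max_i msize (F i))%N => i; apply: bounded_le (bounded_msize (p := F i)) => _.
exact: (leq_bigmax (F := fun i => msize (F i))).
Qed.

(* Siegel's lemma: there are more unknown coefficients in a box than equations. *)
Lemma ore_left q r (C : 'M[D]_(q, r)) : (r < q)%N ->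
  exists t : 'rV[D]_q, t != 0 /\ t *m C = 0.
Proof.
move=> lt_rq; have [d bd] := bounded_family (fun ij : 'I_q * 'I_r => C ij.1 ij.2).
have [N ltN] := box_growth (n + n) r d.
have := @box_dependence K (n + n) 'I_q 'I_r (fun i j p => wmulr (C i j) p) N (N + d).
case=> [i j|i j p bp||s [[i si] sC]].
- exact: linearP.
- exact: (bounded_wmul bp (bd (i, j))).
- rewrite !card_ord; apply: leq_trans ltN _; rewrite leq_mul2r lt_rq orbT.
  by [].
exists (\row_i (s i : D)); split.
  by apply: contraNneq si => /rowP/(_ i); rewrite !mxE => ->.
by apply/rowP => j; rewrite !mxE -[RHS](sC j); apply: eq_bigr => k _; rewrite mxE.
Qed.

Lemma ore_right q r (C : 'M[D]_(q, r)) : (q < r)%N ->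
  exists h : 'cV[D]_r, h != 0 /\ C *m h = 0.
Proof.
move=> lt_qr; have [d bd] := bounded_family (fun ij : 'I_q * 'I_r => C ij.1 ij.2).
have [N ltN] := box_growth (n + n) q d.
have := @box_dependence K (n + n) 'I_r 'I_q (fun j i p => wmul (C i j) p) N (N + d).
case=> [i j|i j p bp||s [[i si] sC]].
- exact: linearP.
- rewrite addnC; exact: (bounded_wmul (bd (j, i)) bp).
- rewrite !card_ord; apply: leq_trans ltN _; rewrite leq_mul2r lt_qr orbT.
  by [].
exists (\col_i (s i : D)); split.
  by apply: contraNneq si => /colP/(_ i); rewrite !mxE => ->.
by apply/colP => j; rewrite !mxE -[RHS](sC j); apply: eq_bigr => k _; rewrite mxE.
Qed.

Definition row_indep q r (M : 'M[D]_(q, r)) := forall t : 'rV[D]_q, t *m M = 0 -> t = 0.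

Lemma row_indep_leq q r (M : 'M[D]_(q, r)) : row_indep M -> (q <= r)%N.
Proof.
move=> iM; rewrite leqNgt; apply/negP => /(ore_left M)[t [t0 /iM tE]].
by rewrite tE eqxx in t0.
Qed.

(** Independent families have at most r rows, so adding rows from [P] must stop; a row that cannot
    be added satisfies a relation with nonzero coefficient [t]. *)
Lemma row_indep_max r (P : 'rV[D]_r -> Prop) q0 (X : 'M[D]_(q0, r)) :
  row_indep X ->
  exists q (W : 'M[D]_(q, r)), [/\ forall i, P (row i W), row_indep (col_mx X W) &
    forall rho, P rho -> exists t w1 w2, t != 0 /\ t *: rho = w1 *m X + w2 *m W].
Proof.
move=> iX; apply: NNPP => H.
have ext q (W : 'M[D]_(q, r)) : (forall i, P (row i W)) -> row_indep (col_mx X W) ->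
    exists W' : 'M[D]_(q + 1, r), (forall i, P (row i W')) /\ row_indep (col_mx X W').
  move=> PW iW; apply: NNPP => H'; apply: H; exists q, W; split => // rho Prho.
  apply: NNPP => H''; apply: H'; exists (col_mx W rho); split.
    move=> i; rewrite -(splitK i); case: split => j /=; first by rewrite rowKu.
    by rewrite rowKd (_ : row j rho = rho) //; apply/rowP => k; rewrite mxE ord1.
  move=> t; rewrite -(hsubmxK t) -[rsubmx t]hsubmxK !mul_row_col.
  set t1 := lsubmx _; set t2 := lsubmx _; set t3 := rsubmx _ => E.
  have t30 : t3 = 0.
    apply/rowP => i; rewrite ord1 [RHS]mxE; apply/eqP; apply/negPn/negP => nz; apply: H''.
    exists (t3 0 0), (- t1), (- t2); split => //.
    rewrite !mulNmx -opprD; apply/eqP; rewrite -addr_eq0; apply/eqP.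
    by rewrite addrC -mul_scalar_mx -mx11_scalar -addrA E.
  have /iW : row_mx t1 t2 *m col_mx X W = 0.
    by rewrite mul_row_col -[RHS]E t30 mul0mx addr0.
  by rewrite -row_mx0 => /eq_row_mx[-> ->]; rewrite t30 !row_mx0.
have all q : exists W : 'M[D]_(q, r), (forall i, P (row i W)) /\ row_indep (col_mx X W).
  elim: q => [|q [W [PW iW]]].
    exists (const_mx 0); split=> [[] //|t].
    rewrite -(hsubmxK t) mul_row_col [rsubmx t *m _](_ : _ = 0) ?addr0.
      by move=> /iX ->; rewrite (thinmx0 (rsubmx t)) row_mx0.
    by rewrite (flatmx0 (const_mx 0)) mulmx0.
  by have := ext _ W PW iW; rewrite addn1.
case: (all r.+1) => W [_ /row_indep_leq]; lia.
Qed.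

Lemma scalemx_eq0 p q t (M : 'M[D]_(p, q)) : t != 0 -> t *: M = 0 -> M = 0.
Proof.
move=> t0 tM; apply/matrixP => i j; have /matrixP/(_ i j)/eqP := tM.
by rewrite !mxE wmul_eq0 (negbTE t0) => /eqP.
Qed.

(** Extend a maximal independent family [M] of [N] by [v] and then by [W] to a maximal one. Without
    [v] it has fewer than r rows, so some nonzero column kills [M] and [W]. If it killed [v] too, it
    would kill every unit row, each being torsion modulo the whole family. *)
Lemma ore_functional r (N : 'rV[D]_r -> Prop) (v : 'rV[D]_r) :
  (forall t, N (t *: v) -> t = 0) ->
  (forall c x y, N x -> N y -> N (c *: x + y)) -> N 0 ->
  exists h : 'cV[D]_r, (forall x, N x -> x *m h = 0) /\ v *m h != 0.
Proof.
move=> vN Nlin N0.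
have Nmul q (M : 'M[D]_(q, r)) (t : 'rV[D]_q) : (forall i, N (row i M)) -> N (t *m M).
  move=> NM; rewrite mulmx_sum_row; elim/big_ind: _ => // [x y Nx Ny|i _].
    by rewrite -[x]scale1r; apply: Nlin.
  by rewrite -[_ *: _]addr0; apply: Nlin.
have i0 : row_indep (const_mx 0 : 'M[D]_(0, r)) by move=> t _; apply/rowP => -[].
case: (row_indep_max N i0) => q [M [NM iM maxM]].
have iMv : row_indep (col_mx M v).
  move=> t; rewrite -(hsubmxK t) mul_row_col.
  set t1 := lsubmx _; set t2 := rsubmx _ => E.
  have t20 : t2 = 0.
    apply/rowP => i; rewrite ord1 [RHS]mxE; apply: vN.
    rewrite -mul_scalar_mx -mx11_scalar.
    have -> : t2 *m v = (-1) *: (t1 *m M) + 0.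
      by apply/eqP; rewrite addr0 scaleN1r -addr_eq0 addrC E.
    by apply: Nlin => //; apply: Nmul.
  have /iM : row_mx (0 : 'rV_0) t1 *m col_mx (const_mx 0 : 'M[D]_(0, r)) M = 0.
    by rewrite mul_row_col mul0mx add0r -[RHS]E t20 mul0mx addr0.
  by rewrite -row_mx0 => /eq_row_mx[_ ->]; rewrite t20 row_mx0.
case: (row_indep_max (fun=> True) iMv) => q' [W [_ iW maxW]].
have lt : (q + q' < r)%N by have := row_indep_leq iW; lia.
case: (ore_right (col_mx M W) lt) => h [h0 /eqP].
rewrite mul_col_mx col_mx_eq0 => /andP[/eqP Mh /eqP Wh].
exists h; split.
  move=> x /maxM[t [w1 [w2 [t0 E]]]].
  apply: (scalemx_eq0 t0).
  by rewrite scalemxAl E (thinmx0 w1) mul0mx add0r -mulmxA Mh mulmx0.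
apply: contraNneq h0 => vh; apply/eqP/colP => j.
case: (maxW (delta_mx 0 j) I) => t [w1 [w2 [t0 E]]].
suff : (delta_mx 0 j : 'rV[D]_r) *m h = 0.
  by rewrite -rowE => /rowP/(_ 0); rewrite !mxE.
apply: (scalemx_eq0 t0).
by rewrite scalemxAl E mulmxDl -!mulmxA Wh mulmx0 addr0 mul_col_mx Mh vh col_mx0 mulmx0.
Qed.

End OreConditions.

(** * Specialization of a field of characteristic 0 *)

Section Specialization.
Context (K : fieldType).

(* [psi] is a ring morphism defined on B that factors through the subring f(B)
   of K. *)
Definition specializable (B : comNzRingType) (f : {rmorphism B -> K}) :=
  forall c, f c != 0 ->
  exists (k : closedFieldType) (p : nat) (psi : {rmorphism B -> k}),
    [/\ p \in [pchar k], forall b, f b = 0 -> psi b = 0 & psi c != 0].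

Lemma specializable_int : [pchar K] =i pred0 -> specializable (intmul (1 : K)).
Proof.
move=> charK c c0; have cz : c != 0 by apply: contraNneq c0 => ->; rewrite rmorph0.
(* A prime above the absolute value of [c] does not divide it. *)
have [p lt_cp pr_p] := prime_above `|c|.
have [k [Fk _]] := countable_algebraic_closure 'F_p.
have charF : p \in [pchar 'F_p] by apply: pchar_Fp.
have chark : p \in [pchar k] by rewrite (fmorph_pchar Fk).
exists k, p, (intmul (1 : k)); split => //.
- have /pcharf0P natK := charK; move=> b /eqP.
  have -> : (b%:~R == 0 :> K) = (b == 0); last by move/eqP ->; rewrite rmorph0.
  by case: b => m; rewrite ?NegzE ?mulrNz ?oppr_eq0 -pmulrn natK.
- have -> : (c%:~R == 0 :> k) = (`|c|%N%:R == 0 :> k).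
    by case: (c) => m //=; rewrite NegzE mulrNz oppr_eq0.
  rewrite -(dvdn_pcharf chark) gtnNdvd // absz_gt0 //.
Qed.

Lemma exists_minimal (T : Type) (m : T -> nat) (Q : T -> Prop) :
  (exists x, Q x) -> exists x, Q x /\ forall y, Q y -> (m x <= m y)%N.
Proof.
case=> x Qx; have [N le] := ubnP (m x); elim: N => // N IH in x Qx le *.
have [[y [Qy lt]]|H] := classic (exists y, Q y /\ (m y < m x)%N).
  by apply: (IH y Qy); apply: leq_trans lt _.
exists x; split => // y Qy; rewrite leqNgt; apply/negP => lt.
by apply: H; exists y.
Qed.

Section Adjoin.
Context (B : comNzRingType) (f : {rmorphism B -> K}) (g : K).

Let F : {rmorphism {poly B} -> K} := horner_morph (fun x => mulrC g (f x)).

Let FE Q : F Q = (map_poly f Q).[g]. Proof. by []. Qed.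

(** As [f] need not be injective, the leading coefficient may die in K; cutting [S] at the size of
    its image repairs this without changing the image. *)
Let trim (S : {poly B}) : map_poly f S != 0 ->
  exists S' : {poly B}, [/\ map_poly f S' = map_poly f S,
    f (lead_coef S') != 0 & size S' = size (map_poly f S)].
Proof.
move=> S0; set d := size (map_poly f S); exists (\poly_(i < d) S`_i).
have d0 : (0 < d)%N by rewrite size_poly_gt0.
have lc : f S`_d.-1 = lead_coef (map_poly f S) by rewrite lead_coefE coef_map.
have lc0 : f S`_d.-1 != 0 by rewrite lc lead_coef_eq0.
have lc1 : S`_d.-1 != 0 by apply: contraNneq lc0 => ->; rewrite rmorph0.
have sz : size (\poly_(i < d) S`_i) = d by apply: size_poly_eq.
split => //; last by rewrite lead_coefE sz coef_poly prednK // leqnn.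
apply/polyP => i; rewrite !coef_map coef_poly; case: ltnP => // le_di.
by rewrite raddf0 -[RHS]coef_map nth_default.
Qed.

Let size_trim (S : {poly B}) : f (lead_coef S) != 0 -> size (map_poly f S) = size S.
Proof. exact: size_map_poly_id0. Qed.

Let pdiv (P S : {poly B}) : S != 0 -> exists a T R,
  P * (lead_coef S ^+ a)%:P = T * S + R /\ (size R < size S)%N.
Proof.
move=> S0; exists (Pdiv.Ring.rscalp P S), (Pdiv.Ring.rdivp P S), (Pdiv.Ring.rmodp P S).
split; last exact: Pdiv.Ring.ltn_rmodpN0.
by apply: Pdiv.RingComRreg.rdivp_eq; apply: mulrC.
Qed.

Let size_map_le (R : {poly B}) : (size (map_poly f R) <= size R)%N.
Proof. exact: size_poly. Qed.

(* For g algebraic, P is a polynomial of least degree over f(B) vanishing at g,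
   and S is a constant r such that r is a multiple of q(g): it then suffices to
   keep lead_coef P and r nonzero and to send g to a root of P. *)
Lemma specializable_adjoin : specializable f -> specializable F.
Proof.
move=> spf q Fq0.
have [[P0 [FP0 P00]]|trans] :=
  classic (exists P, F P = 0 /\ map_poly f P != 0); last first.
  (* The transcendental case: a trimmed leading coefficient of [q] is kept nonzero by [psi], and [g]
     goes to any non-root of the reduced polynomial. *)
  have qf0 : map_poly f q != 0 by apply: contraNneq Fq0; rewrite FE => ->; rewrite horner0.
  have [q' [qE lq' _]] := trim qf0.
  have [k [p [psi [pk ker psiq]]]] := spf _ lq'.
  have : map_poly psi q != 0.
    apply/negP => /eqP/polyP z; case/negP: psiq.
    have E : f (q'`_(size q').-1 - q`_(size q').-1) = 0.
      have := congr1 (fun z : {poly K} => z`_(size q').-1) qE; rewrite !coef_map /= => E.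
      by rewrite rmorphB /= E subrr.
    move/ker: E; rewrite rmorphB => /eqP; rewrite subr_eq0 lead_coefE => /eqP ->.
    by rewrite -coef_map z coef0.
  case/closed_nonrootP => g' g'q.
  exists k, p, (horner_morph (fun x => mulrC g' (psi x))); split => // Q FQ.
  have fQ : map_poly f Q = 0.
    by apply/eqP/negPn/negP => nz; apply: trans; exists Q.
  rewrite /= /horner_morph (_ : map_poly psi Q = 0) ?horner0 //.
  apply/polyP => i; rewrite coef_map coef0; apply: ker.
  by rewrite -coef_map fQ coef0.
have [P1 [[FP1 P10] minP1]] := @exists_minimal _ (fun P => size (map_poly f P))
  (fun P => F P = 0 /\ map_poly f P != 0) (ex_intro _ P0 (conj FP0 P00)).
have [P [PE lP szP]] := trim P10.
have minP Q : F Q = 0 -> (size (map_poly f Q) < size P)%N -> map_poly f Q = 0.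
  move=> FQ; rewrite szP ltnNge => H; apply/eqP; apply: contraNT H => nz.
  exact: minP1.
have FP : F P = 0 by rewrite FE PE.
have P_neq0 : P != 0 by apply: contraNneq lP => ->; rewrite lead_coef0 rmorph0.
have szP1 : (1 < size P)%N.
  rewrite ltnNge; apply/negP => /size1_polyC PC; move: lP FP.
  by rewrite PC lead_coefC /F /= horner_morphC => /negbTE nz /eqP; rewrite nz.
(* A Bezout argument without division: among polynomials whose value at [g] is a nonzero multiple of
   that of [q], one of least size turns out to be constant. *)
have [[S1 U1] [[/= FS1 S1E] minS]] := @exists_minimal _
  (fun SU : {poly B} * {poly B} => size (map_poly f SU.1))
  (fun SU => F SU.1 != 0 /\ F SU.1 = F (SU.2 * q))
  (ex_intro _ (q, 1) (conj Fq0 (congr1 F (esym (mul1r q))))).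
have S10 : map_poly f S1 != 0 by apply: contraNneq FS1; rewrite FE => ->; rewrite horner0.
have [S [SE lS szS]] := trim S10.
have FS : F S = F (U1 * q) by apply: etrans S1E; rewrite !FE SE.
have FS0 : F S != 0 by rewrite FE SE.
have S_neq0 : S != 0 by apply: contraNneq FS0 => ->; rewrite rmorph0.
have minS' R U : F R = F (U * q) -> (size R < size S)%N -> F R = 0.
  move=> RE lt; apply/eqP/negPn/negP => nz; have := minS (R, U) (conj nz RE).
  by rewrite /= leqNgt -szS (leq_ltn_trans (size_map_le R) lt).
(* Pseudo-division by [P] makes [S] shorter than [P]. Dividing [P] by a nonconstant [S] leaves a
   remainder vanishing at [g], by minimality of [S]; the quotient then vanishes at [g] and is
   shorter than [P], so its image is 0, against the leading term. *)
have szS1 : (size S <= 1)%N.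
  rewrite leqNgt; apply/negP => lt1S.
  have ltSP : (size S < size P)%N.
    rewrite ltnNge; apply/negP => lePS.
    have [a [T [R [E ltR]]]] := pdiv S P_neq0.
    have FR : F R = F S * f (lead_coef P) ^+ a.
      move/(congr1 F): E; rewrite rmorphD !rmorphM FP mulr0 add0r => <-.
      by rewrite {2}/F /= horner_morphC rmorphXn.
    have : F R = 0.
      apply: (minS' _ ((lead_coef P ^+ a)%:P * U1)); last exact: leq_trans ltR lePS.
      by rewrite FR FS -mulrA [RHS]rmorphM {2}/F /= horner_morphC rmorphXn mulrC.
    by move/eqP; rewrite FR mulf_eq0 (negbTE FS0) expf_eq0 (negbTE lP) andbF.
  have [a [T [R [E ltR]]]] := pdiv P S_neq0.
  have FE1 : F T * F S + F R = 0.
    by move/(congr1 F): E; rewrite rmorphD !rmorphM FP mul0r.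
  have FR : F R = 0.
    apply: (minS' _ (- T * U1)) => //; rewrite -mulrA rmorphM -FS rmorphN mulNr.
    by apply/eqP; rewrite -addr_eq0 addrC FE1.
  have fR : map_poly f R = 0.
    apply: minP => //; apply: leq_ltn_trans (size_map_le R) _.
    exact: ltn_trans ltR ltSP.
  have FT : F T = 0.
    by move/eqP: FE1; rewrite FR addr0 mulf_eq0 (negbTE FS0) orbF => /eqP.
  have E' : map_poly f P * (f (lead_coef S) ^+ a)%:P = map_poly f T * map_poly f S.
    have := congr1 (map_poly f) E; rewrite rmorphD !rmorphM /= fR addr0 map_polyC /=.
    by rewrite rmorphXn.
  have lhs0 : map_poly f P * (f (lead_coef S) ^+ a)%:P != 0.
    rewrite mulf_neq0 // ?polyC_eq0 ?expf_neq0 //.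
    by rewrite -size_poly_gt0 size_trim // size_poly_gt0.
  have fT0 : map_poly f T != 0 by apply: contraNneq lhs0 => T0; rewrite E' T0 mul0r.
  have fS0 : map_poly f S != 0 by rewrite SE.
  case/negP: (fT0); apply/eqP; apply: minP => //.
  have szE : size (map_poly f P * (f (lead_coef S) ^+ a)%:P) =
      size (map_poly f T * map_poly f S) by rewrite E'.
  move: szE; rewrite mulrC mul_polyC size_scale ?expf_neq0 // size_mul //.
  rewrite (size_trim lP) (size_trim lS) => szE; rewrite szE.
  by case: (size S) lt1S => [|[|s]] // _; rewrite !addnS ltnS leq_addr.
have [r Sr] : exists r, S = r%:P by exists S`_0; apply: size1_polyC.
have fr : f r != 0 by move: FS0; rewrite Sr /F /= horner_morphC.
have [k [p [psi [pk ker psic]]]] : exists (k : closedFieldType) p (psi : {rmorphism B -> k}),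
    [/\ p \in [pchar k], forall b, f b = 0 -> psi b = 0 & psi (lead_coef P * r) != 0].
  by apply: spf; rewrite rmorphM mulf_neq0.
move: psic; rewrite rmorphM mulf_eq0 negb_or => /andP[psiP psir].
have szpsiP : size (map_poly psi P) = size P by apply: size_map_poly_id0.
have /closed_rootP[g' /rootP g'P] : size (map_poly psi P) != 1%N.
  by rewrite szpsiP neq_ltn szP1 orbT.
pose G : {rmorphism {poly B} -> k} := horner_morph (fun x => mulrC g' (psi x)).
(* Pseudo-divide by [P]: the remainder has image 0 by minimality, and the power of [lead_coef P] can
   be cancelled since [psi] keeps it nonzero. *)
have kerG Q : F Q = 0 -> G Q = 0.
  move=> FQ; have [a [T [R [E ltR]]]] := pdiv Q P_neq0.
  have FR : F R = 0.
    by move/(congr1 F): E; rewrite rmorphD !rmorphM FP FQ mul0r mulr0 add0r.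
  have fR : map_poly f R = 0 by apply: minP => //; apply: leq_ltn_trans (size_map_le R) ltR.
  have GR : G R = 0.
    rewrite /G /= /horner_morph (_ : map_poly psi R = 0) ?horner0 //.
    apply/polyP => i; rewrite coef_map coef0; apply: ker.
    by rewrite -coef_map fR coef0.
  have GP : G P = 0 by [].
  move/(congr1 G): E; rewrite rmorphD !rmorphM GP GR mulr0 addr0 {2}/G /= horner_morphC.
  by move/eqP; rewrite mulf_eq0 rmorphXn expf_eq0 (negbTE psiP) andbF orbF => /eqP.
exists k, p, G; split => //.
have : G (S - U1 * q) = 0 by apply: kerG; rewrite rmorphB FS subrr.
rewrite rmorphB rmorphM => /eqP; rewrite subr_eq0 => /eqP GS.
apply: contraNneq psir => Gq.
by move: GS; rewrite Gq mulr0 Sr /G /= horner_morphC => ->.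
Qed.

Lemma adjoin_const b : F b%:P = f b.
Proof. exact: horner_morphC. Qed.

Lemma adjoin_gen : F 'X = g.
Proof. exact: horner_morphX. Qed.

End Adjoin.

Lemma specializable_seq (s : seq K) : [pchar K] =i pred0 ->
  exists (B : comNzRingType) (f : {rmorphism B -> K}),
    specializable f /\ forall x, x \in s -> exists b, f b = x.
Proof.
move=> charK; elim: s => [|g s [B [f [spf fs]]]].
  by exists int, (intmul (1 : K)); split; first exact: specializable_int.
exists {poly B}, (horner_morph (fun x => mulrC g (f x))); split.
  exact: specializable_adjoin.
move=> x; rewrite inE => /predU1P[->|/fs[b <-]].
  by exists 'X; apply: adjoin_gen.
by exists b%:P; apply: adjoin_const.
Qed.

End Specialization.

(** * Iterated brackets in characteristic p *)

Definition ad (A : nzRingType) (y b : A) : A := y * b - b * y.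

Lemma ad_is_additive (A : nzRingType) (y : A) : additive (ad y).
Proof. by move=> a b; rewrite /ad mulrBr mulrBl !opprD !opprK addrACA. Qed.
HB.instance Definition _ (A : nzRingType) (y : A) :=
  GRing.isZmodMorphism.Build A A (ad y) (ad_is_additive y).

Lemma adM (A : nzRingType) (y a b : A) : ad y (a * b) = ad y a * b + a * ad y b.
Proof. by rewrite /ad mulrBl mulrBr !mulrA addrA subrK. Qed.

Lemma iter_ad_sum (A : nzRingType) (y : A) j (I : Type) (r : seq I) (P : pred I) (F : I -> A) :
  iter j (ad y) (\sum_(i <- r | P i) F i) = \sum_(i <- r | P i) iter j (ad y) (F i).
Proof. by elim: j => //= j ->; rewrite raddf_sum. Qed.

Lemma iter_ad_const (A : nzRingType) (y c a : A) j :
  ad y c = 0 -> iter j (ad y) (c * a) = c * iter j (ad y) a.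
Proof. by move=> yc; elim: j => //= j ->; rewrite adM yc mul0r add0r. Qed.

Lemma rmorph_iter_ad (A B : nzRingType) (f : {rmorphism A -> B}) y a j :
  f (iter j (ad y) a) = iter j (ad (f y)) (f a).
Proof. by elim: j => //= j <-; rewrite rmorphB !rmorphM. Qed.

Lemma iter_ad_wgen (R : comNzRingType) n g (a : weyl R n) j :
  iter j (ad (wgen g)) a =
  wsign R g ^+ j *: iter j (wderiv (wconj g)) a.
Proof.
elim: j => [|j IH] /=; first by rewrite scale1r.
by rewrite IH [ad _ _]wgen_comm linearZ_LR scalerA -exprS.
Qed.

Lemma weyl_central (R : comNzRingType) n (z : weyl R n) :
  (forall g, ad (wgen g) z = 0) -> forall a, ad a z = 0.
Proof.
move=> zg; elim/weyl_ind => [|c a b IH IH'|g a IH].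
- by rewrite /ad mul1r mulr1 subrr.
- by rewrite /ad mulrDl mulrDr -scalerAl -scalerAr opprD addrACA -scalerBr
    -!/(ad _ _) IH IH' scaler0 addr0.
- move/eqP: IH; rewrite subr_eq0 => /eqP IH; have /eqP := zg g; rewrite subr_eq0 => /eqP E.
  by rewrite /ad -mulrA IH mulrA E mulrA subrr.
Qed.

(** * Independence of the images of monomials over the centralizer of the image *)

Section CentralizerIndependence.
Context (k : fieldType) (n : nat) (phi : {lrmorphism weyl k n -> weyl k n}).
Local Notation A := (weyl k n).

(** The bracket with the image of the conjugate generator passes over the [C i] and differentiates
    the [a i]. *)
Lemma centralizer_mderiv (I : finType) (C a : I -> A) h :
  (forall i g, ad (phi (wgen g)) (C i) = 0) ->
  \sum_i C i * phi (a i) = 0 ->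
  \sum_i C i * phi (wderiv h (a i)) = 0.
Proof.
move=> Cc /(congr1 (ad (phi (wgen (wconj h))))); rewrite raddf0 raddf_sum /= => E'.
have -> : \sum_i C i * phi (wderiv h (a i)) =
   wsign k (wconj h) *: \sum_i ad (phi (wgen (wconj h))) (C i * phi (a i)).
  rewrite scaler_sumr; apply: eq_bigr => i _.
  rewrite adM Cc mul0r add0r /ad -!rmorphM -rmorphB wgen_comm wconjK.
  by rewrite /= (linearZ_LR phi) -scalerAr scalerA wsign_sqr scale1r.
by rewrite E' scaler0.
Qed.

Lemma centralizer_mderivm (I : finType) (C a : I -> A) m :
  (forall i g, ad (phi (wgen g)) (C i) = 0) ->
  \sum_i C i * phi (a i) = 0 ->
  \sum_i C i * phi (mderivm m (a i : {mpoly k[n + n]}) : A) = 0.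
Proof.
move=> Cc E; rewrite /mderivm; elim: (enum _) => //= g s IH.
by elim: (m g) => //= j; apply: centralizer_mderiv.
Qed.

(** Take [i] with [C i] nonzero and [m i] of largest degree. Differentiating [m i] times kills every
    other monomial of at most that degree and leaves [C i] times a product of factorials. The
    hypothesis on factorials covers characteristic 0 as well as exponents below p in characteristic
    p. *)
Lemma centralizer_indep (I : finType) (m : I -> 'X_{1..n + n}) (C : I -> A) :
  injective m -> (forall i g, ((m i g)`!)%:R != 0 :> k) ->
  (forall i g, ad (phi (wgen g)) (C i) = 0) ->
  \sum_i C i * phi 'X_[m i] = 0 -> forall i, C i = 0.
Proof.
move=> minj mfact Cc E i1; apply/eqP/negPn/negP => Ci1.
case: (@arg_maxnP _ i1 (fun i => C i != 0) (fun i => mdeg (m i)) Ci1) => i Ci maxi.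
have := centralizer_mderivm (m i) Cc E.
rewrite (bigD1 i) //= big1 ?addr0 => [|j ji].
  rewrite mderivmX (linearZ_LR phi) -scalerAr => /eqP.
  rewrite scaler_eq0 (_ : (m i - m i)%MM = 0%MM); last first.
    by apply/mnmP => g; rewrite mnmBE mnm0E subnn.
  rewrite mpolyX0 (rmorph1 phi) mulr1 (negbTE Ci) orbF; apply/negP.
  rewrite natr_prod prodf_seq_neq0; apply/allP => g _ /=.
  by rewrite ffactnn; apply: mfact.
have [->|Cj] := eqVneq (C j) 0; first by rewrite mul0r.
rewrite mderivmX; have [g lt] : exists g, (m j g < m i g)%N.
  apply/existsP; apply: contraNT ji => /existsPn H; apply/eqP/minj/esym.
  have le g : (m i g <= m j g)%N by rewrite leqNgt H.
  have : (mdeg (m j) <= mdeg (m i))%N by apply: maxi.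
  rewrite -{1}(submK (introT mnm_lepP le)) mdegD -{2}[mdeg (m i)]add0n leq_add2r leqn0.
  by rewrite mdeg_eq0 => /eqP z; rewrite -(submK (introT mnm_lepP le)) z add0m.
by rewrite (bigD1 g) //= ffact_small // mul0n scale0r (raddf0 phi) mulr0.
Qed.

End CentralizerIndependence.

Section CharP.
Context (k : fieldType) (p : nat) (pk : p \in [pchar k]) (n : nat).
Local Notation A := (weyl k n).

(* x^i d^j is sent to the central monomial x^(p i) d^(p j). *)
Let frob (s : A) : A := linext (fun l : 'X_{1..n + n} => 'X_[(l *+ p)%MM]) (s : {mpoly k[n + n]}).

Let p_prime : prime p := pcharf_prime pk.

Let frob_coef s l : (frob s)@_(l *+ p)%MM = s@_l.
Proof.
rewrite /frob /linext raddf_sum /=.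
have inj (l' : 'X_{1..n + n}) : ((l' *+ p)%MM == (l *+ p)%MM) = (l' == l).
  apply/eqP/eqP => [/mnmP E|-> //]; apply/mnmP => i.
  by move: (E i); rewrite !mulmnE => /eqP; rewrite eqn_pmul2r ?prime_gt0 // => /eqP.
under eq_bigr => l' _ do rewrite mcoeffZ mcoeffX inj.
case: (boolP (l \in msupp s)) => [ls|ls].
  rewrite (bigD1_seq l) ?msupp_uniq //= eqxx mulr1 big1 ?addr0 // => l' /negbTE ->.
  by rewrite mulr0.
rewrite (memN_msupp_eq0 ls) big_seq big1 // => l' l's.
by case: eqP => [E|_]; rewrite ?mulr0 //; rewrite E (negbTE ls) in l's.
Qed.

Let frob_neq0 s : s != 0 -> frob s != 0.
Proof.
apply: contraNneq => s0; apply/eqP/mpolyP => l.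
by rewrite -frob_coef s0 !mcoeff0.
Qed.

Let frob_central s a : ad a (frob s) = 0.
Proof.
apply: weyl_central => g; rewrite [LHS]wgen_comm (_ : wderiv _ _ = 0) ?scaler0 //.
rewrite /frob /linext linear_sum big1 // => l _; rewrite linearZ_LR /= /wderiv mderivX.
by rewrite mulmnE natrM (pcharf0 pk) mulr0 scale0r scaler0.
Qed.

Let frob_bounded N s : bounded (fun=> N) s -> bounded (fun=> (p * N)%N) (frob s).
Proof.
move=> bs; rewrite /frob /linext big_seq; apply: bounded_sum => l ls.
apply: boundedZ; apply: boundedX => g; rewrite mulmnE mulnC leq_mul2l.
by rewrite bs // orbT.
Qed.

(* Over the central Frobenius subalgebra, a is dependent on the p^(2n) elements
   phi(x^i d^j) with exponents below p, which are killed by ad^p. *)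
Lemma pchar_ad_nilpotent (phi : {lrmorphism A -> A}) g a :
  iter p (ad (phi (wgen g))) a = 0.
Proof.
pose E := {ffun 'I_(n + n) -> 'I_p}.
pose m (e : E) : 'X_{1..n + n} := [multinom (e i : nat) | i < n + n].
pose v (i : option E) := if i is Some e then phi 'X_[m e] else a.
have [d bd] := bounded_family v.
(* There are p^(2n) + 1 unknown boxes of side N + 1, against one target box of side p N + d + 1,
   which is at most p (N + d + 1). *)
have [N ltN] := box_growth (n + n) (p ^ (n + n)) d.
have := @box_dependence k (n + n) (option E) unit (fun i _ s => frob s * v i) N (p * N + d).
case=> [i _ c s t|i _ s bs||s [[i1 si1] sE]].
- by rewrite [frob _]linearP mulrDl -scalerAl.
- exact: (bounded_wmul (frob_bounded bs) (bd i)).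
- rewrite card_unit mul1n card_option card_ffun !card_ord.
  apply: leq_ltn_trans ltN; rewrite -expnMn; case: (posnP (n + n)) => [->|m0].
    by rewrite !expn0.
  have := prime_gt0 p_prime; rewrite leq_exp2r //; nia.
have {}sE := sE tt; rewrite -big_enum /= in sE.
have sE' : frob (s None) * a + \sum_e frob (s (Some e)) * phi 'X_[m e] = 0.
  rewrite -[RHS]sE big_enum /= (bigD1 None) //=; congr (_ + _).
  rewrite (reindex_omap Some id) => [|[e|] //]; apply: eq_bigl => e.
  by rewrite eqxx.
have minj : injective m.
  move=> e e' /mnmP H; apply/ffunP => i; apply: val_inj.
  by move: (H i); rewrite !mnmE.
have mfact e h : ((m e h)`!)%:R != 0 :> k.
  rewrite -(dvdn_pcharf pk) mnmE; have := ltn_ord (e h).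
  elim: (e h : nat) => [|j IH] lt; first by rewrite fact0 dvdn1 neq_ltn prime_gt1 ?orbT.
  rewrite factS Euclid_dvdM // negb_or IH 1?ltnW // andbT.
  by rewrite gtnNdvd.
(* Otherwise the images of the monomials would be dependent over the centre. *)
have sN0 : s None != 0.
  apply: contraNneq si1 => s0; case: i1 => [e|]; last by rewrite s0.
  have f0 : frob 0 = 0 by rewrite /frob raddf0.
  move: sE'; rewrite s0 f0 mul0r add0r => /(@centralizer_indep k n phi _ m _ minj mfact).
  move=> /(_ (fun e h => frob_central _ _)) z.
  by apply/negPn/negP => /frob_neq0; rewrite z eqxx.
have := congr1 (iter p (ad (phi (wgen g)))) sE'.
rewrite (_ : iter p _ 0 = 0); last first.
  by elim: (p) => //= j ->; rewrite raddf0.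
have iterD u w : iter p (ad (phi (wgen g))) (u + w) =
    iter p (ad (phi (wgen g))) u + iter p (ad (phi (wgen g))) w.
  by elim: (p) => //= j ->; rewrite raddfD.
rewrite iterD iter_ad_const // iter_ad_sum big1 ?addr0 => [/eqP|e _].
  by rewrite wmul_eq0 (negbTE (frob_neq0 sN0)) => /eqP.
rewrite iter_ad_const // -rmorph_iter_ad iter_ad_wgen -[iter p _ _]mderivn_iter mderivnX.
by rewrite mnmE ffact_small ?ltn_ord // scale0r scaler0 (raddf0 phi) mulr0.
Qed.

End CharP.

(** * Degrees in recurrences *)

Lemma argmax_first N (P : pred nat) (f : nat -> rat) : (exists2 i, (i < N)%N & P i) ->
  exists i, [/\ (i < N)%N, P i, forall j, (j < N)%N -> P j -> f j <= f i &
    forall j, (j < i)%N -> P j -> f j < f i].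
Proof.
elim: N => [[] //|N IH] [i0 lt_i0 Pi0].
have [H|H] := classic (exists2 i, (i < N)%N & P i); last first.
  have i0N : i0 = N.
    apply/eqP; rewrite eqn_leq -ltnS lt_i0 leqNgt; apply/negP => lt; apply: H; by exists i0.
  rewrite i0N in Pi0; exists N; split => // j.
    rewrite ltnS leq_eqVlt => /predU1P[-> //|lt Pj]; case: H; by exists j.
  by move=> lt Pj; case: H; exists j.
have [i [lt_iN Pi maxi firsti]] := IH H.
have [/andP[PN ltN]|] := boolP (P N && (f i < f N)).
  exists N; split => // j.
    rewrite ltnS leq_eqVlt => /predU1P[-> //|lt Pj].
    exact: le_trans (maxi j lt Pj) (ltW ltN).
  by move=> lt Pj; apply: le_lt_trans (maxi j lt Pj) ltN.
rewrite negb_and -leNgt => nN; exists i; split => //; first by rewrite ltnS ltnW.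
move=> j; rewrite ltnS leq_eqVlt => /predU1P[->|lt] Pj; last exact: maxi.
by move: nN; rewrite Pj.
Qed.

Lemma argmax_last N (P : pred nat) (f : nat -> rat) : (exists2 i, (i < N)%N & P i) ->
  exists i, [/\ (i < N)%N, P i, forall j, (j < N)%N -> P j -> f j <= f i &
    forall j, (i < j < N)%N -> P j -> f j < f i].
Proof.
elim: N => [[] //|N IH] [i0 lt_i0 Pi0].
have [H|H] := classic (exists2 i, (i < N)%N & P i); last first.
  have i0N : i0 = N.
    apply/eqP; rewrite eqn_leq -ltnS lt_i0 leqNgt; apply/negP => lt; apply: H; by exists i0.
  rewrite i0N in Pi0; exists N; split => // j.
    rewrite ltnS leq_eqVlt => /predU1P[-> //|lt Pj]; case: H; by exists j.
  by move=> lt; exfalso; lia.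
have [i [lt_iN Pi maxi lasti]] := IH H.
have [/andP[PN ltN]|] := boolP (P N && (f i <= f N)).
  exists N; split => // j.
    rewrite ltnS leq_eqVlt => /predU1P[-> //|lt Pj].
    exact: le_trans (maxi j lt Pj) ltN.
  by move=> lt; exfalso; lia.
rewrite negb_and -ltNge => nN; exists i; split => //; first by rewrite ltnS ltnW.
  move=> j; rewrite ltnS leq_eqVlt => /predU1P[->|lt] Pj; last exact: maxi.
  by move: nN; rewrite Pj /= => /ltW.
move=> j /andP[lt_ij]; rewrite ltnS leq_eqVlt => /predU1P[->|lt] Pj.
  by move: nN; rewrite Pj.
by apply: lasti => //; rewrite lt_ij.
Qed.

Ltac size_lia :=
  repeat match goal with H : context [wsize _] |- _ => revert H end;
  repeat match goal with |- context [@wsize ?R ?n ?x] => generalize (@wsize R n x); intro end;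
  intros; lia.

Section Recurrence.
Context (R : idomainType) (n : nat) (g : 'I_(n + n)).
Local Notation D := (weyl R n).
Variables (e : nat) (s b : nat -> D).

(* What a relation between the iterated brackets of x becomes under a linear
   form h, with b m = h (delta^m x), by the Leibniz rule. *)
Definition ad_recurrence := forall m,
  \sum_(i < e.+1) \sum_(j < m.+1)
    (iter j (ad (wgen g)) (s i) * b (i + m - j)%N) *+ 'C(m, j) = 0.

Hypothesis rec : ad_recurrence.

Lemma wsize_iter_ad j (a : D) : (wsize (iter j (ad (wgen g)) a) <= wsize a - j)%N.
Proof.
elim: j => [|j IH] /=; first by rewrite subn0.
by apply: leq_trans (wsize_comm _ _) _; rewrite subnS -!subn1 leq_sub2r.
Qed.

Let term_wsize i j l c :
  (iter j (ad (wgen g)) (s i) * b l) *+ c = 0 \/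
  [/\ s i != 0, b l != 0 &
    (wsize ((iter j (ad (wgen g)) (s i) * b l) *+ c) + j < wsize (s i) + wsize (b l))%N].
Proof.
have [it0|it0] := eqVneq (iter j (ad (wgen g)) (s i)) 0.
  by left; rewrite it0 mul0r mul0rn.
have [bl0|bl0] := eqVneq (b l) 0; first by left; rewrite bl0 mulr0 mul0rn.
right; have le := wsize_iter_ad j (s i).
have it_gt0 : (0 < wsize (iter j (ad (wgen g)) (s i)))%N by rewrite wsize_gt0.
have si0 : s i != 0 by rewrite -wsize_gt0; size_lia.
split => //; apply: leq_ltn_trans (leq_add (wsizeMn _ c) (leqnn j)) _.
by rewrite wsizeM //; move: it_gt0 le; rewrite -wsize_gt0 in bl0; size_lia.
Qed.

(** A sum equal to 0 has no term whose degree strictly exceeds all the others. The summand [j] in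
    the bound is what j brackets take off the degree of [s i]. *)
Let isolate m (i0 : 'I_e.+1) : s i0 != 0 -> b (i0 + m)%N != 0 ->
  ~ (forall (i : 'I_e.+1) j, (j <= m)%N -> (i != i0) || (j != 0%N) ->
     s i != 0 -> b (i + m - j)%N != 0 ->
     (wsize (s i) + wsize (b (i + m - j)) <= wsize (s i0) + wsize (b (i0 + m)) - 1 + j)%N).
Proof.
move=> si0 bi0 H; have := rec m.
rewrite (bigD1 i0) //= (bigD1 ord0) //= bin0 mulr1n subn0 -addrA => /eqP.
rewrite addr_eq0 => /eqP/(congr1 wsize); rewrite wsizeN wsizeM // => E.
have pos : (0 < (wsize (s i0) + wsize (b (i0 + m))).-1)%N.
  by move: si0 bi0; rewrite -!wsize_gt0; size_lia.
suff : ((wsize (s i0) + wsize (b (i0 + m))).-1 < (wsize (s i0) + wsize (b (i0 + m))).-1)%N by rewrite ltnn.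
rewrite {1}E; apply: leq_ltn_trans (wsizeD_le _ _) _; rewrite gtn_max; apply/andP; split.
  apply: wsize_sum_lt => // j j0.
  have [->|[s0 b0 lt]] := term_wsize i0 j (i0 + m - j) 'C(m, j); first by rewrite wsize0.
  have := H i0 j _ _ s0 b0; rewrite -ltnS ltn_ord eqxx /= => /(_ isT j0) le.
  move: lt; rewrite addnC -ltn_subRL => lt; apply: leq_trans lt _.
  by move: le pos; size_lia.
apply: wsize_sum_lt => // i ii0; apply: wsize_sum_lt => // j _.
have [->|[s0 b0 lt]] := term_wsize i j (i + m - j) 'C(m, j); first by rewrite wsize0.
have := H i j _ _ s0 b0; rewrite -ltnS ltn_ord ii0 /= => /(_ isT isT) le.
move: lt; rewrite addnC -ltn_subRL => lt; apply: leq_trans lt _.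
by move: le pos; size_lia.
Qed.

(* Let i0 be the first index of maximal slope
   kap = (deg s_i - deg s_e) / (e - i) and m0 the last index where
   deg b_m - kap * m is maximal. As kap > -1, in the relation of index m0 - i0
   the term s_i0 b_m0 has strictly larger degree than all others. *)
Lemma irregular_recurrence M i1 :
  s e != 0 -> (0 < e)%N -> (forall m, (m < e.-1)%N -> b m = 0) -> b e.-1 != 0 ->
  (i1 < e)%N -> s i1 != 0 -> (wsize (s e) + i1 < wsize (s i1) + e)%N ->
  ~ (forall m, (M <= m)%N -> b m = 0).
Proof.
move=> se0 e0 b0 be lt_i1 si1 irr bM.
pose sl i : rat := ((wsize (s i))%:R - (wsize (s e))%:R) / (e%:R - i%:R).
have [|i0 [lt_i0 si0 maxi firsti]] := @argmax_first e (fun i => s i != 0) sl.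
  by exists i1.
set kap := sl i0 in maxi firsti.
have den i : (i < e)%N -> 0 < e%:R - i%:R :> rat by move=> lt; rewrite subr_gt0 ltr_nat.
have slE i : (i < e)%N -> (wsize (s i))%:R = (wsize (s e))%:R + sl i * (e%:R - i%:R).
  by move=> lt; rewrite /sl divfK ?gt_eqF ?den // addrCA subrr addr0.
(* A slope above -1 at [i1] is exactly the irregularity assumed there. *)
have kap_gt : -1 < kap.
  apply: lt_le_trans (maxi i1 lt_i1 si1).
  rewrite ltr_pdivlMr ?den //; move: irr; rewrite -(ltr_nat rat) !natrD; lra.
pose wt m : rat := (wsize (b m))%:R - kap * m%:R.
have [|m0 [lt_m0 bm0 maxm lastm]] := @argmax_last (maxn M e) (fun m => b m != 0) wt.
  by exists e.-1 => //; rewrite leq_max prednK // leqnn orbT.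
(* The vanishing of the first values of [b] enters here: it gives i0 <= e - 1 <= m0, so the relation
   of index m0 - i0 exists. *)
have le_em : (e.-1 <= m0)%N by rewrite leqNgt; apply/negP => /b0 z; rewrite z eqxx in bm0.
have le_im : (i0 <= m0)%N by apply: leq_trans le_em; rewrite -ltnS prednK.
have lt_i0' : (i0 < e.+1)%N by apply: ltnW.
apply: (@isolate (m0 - i0)%N (Ordinal lt_i0')) => /=; rewrite ?subnKC //.
move=> i j le_j neq s0 b0'; set l := (i + (m0 - i0) - j)%N in b0' *.
have lt_l : (l < maxn M e)%N.
  by rewrite ltnNge geq_max; apply/negP => /andP[/bM z _]; rewrite z eqxx in b0'.
have lE : (l + j + i0 = i + m0)%N by rewrite /l; size_lia.
have lQ : l%:R = i%:R + m0%:R - i0%:R - j%:R :> rat.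
  by have /(congr1 (fun x : nat => x%:R : rat)) := lE; rewrite !natrD; lra.
have kl : kap * l%:R = kap * i%:R + kap * m0%:R - kap * i0%:R - kap * j%:R.
  by rewrite lQ; ring.
have i0E := slE i0 lt_i0; rewrite -/kap mulrBr in i0E.
have siE : (wsize (s i))%:R <= (wsize (s e))%:R + kap * e%:R - kap * i%:R :> rat.
  have := ltn_ord i; rewrite ltnS leq_eqVlt => /predU1P[->|lt]; first by lra.
  rewrite slE //; have := maxi i lt s0; rewrite -(ler_pM2r (den i lt)); lra.
have blE := maxm l lt_l b0'; rewrite /wt in blE.
have pos : (0 < wsize (s i0) + wsize (b m0))%N by move: si0; rewrite -wsize_gt0; size_lia.
suff : (wsize (s i) + wsize (b l) < wsize (s i0) + wsize (b m0) + j)%N.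
  by move: pos; size_lia.
rewrite -(ltr_nat rat) !natrD.
(* For j > 0 the margin is (kap + 1) j. For j = 0 ties are broken by [i0] being the first maximum if
   i < i0, and by [m0] being the last one if i > i0. *)
have [j0|j0] := eqVneq j 0%N; last first.
  have kj : 0 < (kap + 1) * j%:R by rewrite mulr_gt0 ?ltr0n ?lt0n //; lra.
  by rewrite mulrDl mul1r in kj; lra.
have ni : (i : nat) != i0 by move: neq; rewrite j0 eqxx orbF -val_eqE.
have [lt|gt] := ltnP i i0.
  have lt_ie : (i < e)%N by apply: ltn_trans lt lt_i0.
  have := firsti i lt s0; rewrite -(ltr_pM2r (den i lt_ie)).
  have := slE i lt_ie; rewrite j0 mulr0 in kl *; lra.
have lt_ml : (m0 < l < maxn M e)%N by rewrite lt_l andbT; size_lia.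
by have := lastm l lt_ml b0'; rewrite /wt j0 mulr0 in kl *; lra.
Qed.

(* By induction, deg b_m + m stays bounded. *)
Lemma regular_recurrence :
  s e != 0 ->
  (forall i, (i < e)%N -> s i != 0 -> (wsize (s i) + e <= wsize (s e) + i)%N) ->
  exists M, forall m, (M <= m)%N -> b m = 0.
Proof.
move=> se0 reg; pose C := (\max_(m < e) (wsize (b m) + m))%N.
suff H m : b m != 0 -> (wsize (b m) + m <= C)%N.
  exists C.+1 => m ltm; apply/eqP/negPn/negP => bm; have := H m bm.
  by move: bm; rewrite -wsize_gt0; size_lia.
elim/ltn_ind: m => m IH bm.
have [lt|le] := ltnP m e; first exact: (leq_bigmax (F := fun m : 'I_e => (wsize (b m) + m)%N) (Ordinal lt)).
rewrite leqNgt; apply/negP => ltC.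
(* If deg b_m + m exceeded [C], then s_e b_m would dominate the relation of index m - e: all other
   terms involve earlier values of [b], bounded by induction. *)
apply: (@isolate (m - e)%N ord_max) => /=; rewrite ?subnKC //.
move=> i j le_j neq s0 b0; set l := (i + (m - e) - j)%N in b0 *.
have le_i : (i <= e)%N by rewrite -ltnS.
have lt_l : (l < m)%N.
  have : (i != e :> nat) || (j != 0%N) by rewrite -val_eqE in neq.
  by rewrite /l; size_lia.
have := IH l lt_l b0; have : (wsize (s i) + e <= wsize (s e) + i)%N.
  by move: le_i; rewrite leq_eqVlt => /predU1P[->//|lt]; apply: reg.
have lE : (l + j + e = i + m)%N by rewrite /l; size_lia.
by move: ltC lE; rewrite -wsize_gt0 in bm; size_lia.
Qed.

End Recurrence.

(** * Reduction modulo p *)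

Section WeylSpecialization.
Context (K : fieldType) (n : nat).

(** A product of preimages serves as [c]; any other preimage of the same element differs by the
    kernel of [f], which [psi] kills. *)
Lemma specialization_units (B : comNzRingType) (f : {rmorphism B -> K}) (s : seq K) :
  (forall x, x \in s -> exists b, f b = x) -> (forall x, x \in s -> x != 0) ->
  exists c, f c != 0 /\ forall (k : fieldType) (psi : {rmorphism B -> k}),
    (forall b, f b = 0 -> psi b = 0) -> psi c != 0 ->
    forall b, f b \in s -> psi b != 0.
Proof.
elim: s => [|x s IH] im nz; first by exists 1; rewrite rmorph1 oner_neq0.
have [c [c0 Hc]] := IH (fun y ys => im y (mem_behead (s := x :: s) ys))
  (fun y ys => nz y (mem_behead (s := x :: s) ys)).
have [b bx] := im x (mem_head x s).
exists (b * c); split; first by rewrite rmorphM mulf_neq0 // bx nz ?mem_head.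
move=> k psi ker; rewrite rmorphM mulf_eq0 negb_or => /andP[psib psic] b'.
rewrite inE => /predU1P[b'x|]; last exact: Hc.
have : f (b' - b) = 0 by rewrite rmorphB b'x bx subrr.
by move/ker/eqP; rewrite rmorphB subr_eq0 => /eqP ->.
Qed.

(** All coefficients of [E] are adjoined, and the leading ones are kept nonzero, which preserves the
    degrees. *)
Lemma weyl_specialization (E : seq (weyl K n)) : [pchar K] =i pred0 ->
  exists (B : comNzRingType) (f : {rmorphism B -> K}) (k : closedFieldType) (p : nat)
    (psi : {rmorphism B -> k}),
    [/\ p \in [pchar k], forall b, f b = 0 -> psi b = 0,
        forall a, a \in E -> exists a', wmap f a' = a &
        forall a', wmap f a' \in E -> wsize (wmap psi a') = wsize (wmap f a')].
Proof.
move=> charK.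
pose coefs (a : weyl K n) := [seq (a : {mpoly K[n + n]})@_m | m <- msupp a].
have [B [f [spf imf]]] := specializable_seq (flatten (map coefs E)) charK.
have imE (a : weyl K n) m : a \in E -> m \in msupp a -> exists b, f b = a@_m.
  move=> aE ma; apply: imf; apply/flattenP; exists (coefs a); first exact: map_f.
  by apply/mapP; exists m.
pose lcs := [seq mleadc (a : {mpoly K[n + n]}) | a <- E & a != 0].
have [||c [c0 Hc]] := @specialization_units B f lcs.
- move=> x /mapP[a]; rewrite mem_filter => /andP[a0 aE] ->.
  by apply: imE => //; apply: mlead_supp.
- move=> x /mapP[a]; rewrite mem_filter => /andP[a0 aE] ->.
  by rewrite mleadc_eq0.
have [k [p [psi [pk ker psic]]]] := spf c c0.
exists B, f, k, p, psi; split => //.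
  move=> a aE.
  have : forall s : seq 'X_{1..n + n}, {subset s <= msupp a} ->
      exists a', wmap f a' = \sum_(m <- s) (a : {mpoly K[n + n]})@_m *: ('X_[m] : weyl K n).
    elim=> [|m s IH] sub; first by exists 0; rewrite raddf0 big_nil.
    have [|a' a'E] := IH; first by move=> m' m's; apply: sub; rewrite inE m's orbT.
    have [b bE] := imE a m aE (sub m (mem_head m s)).
    exists (b *: ('X_[m] : weyl B n) + a').
    by rewrite raddfD /= wmapZ wmapX bE a'E big_cons.
  case/(_ (msupp a)) => // a' a'E; exists a'; rewrite a'E; exact: esym (mpolyE a).
move=> a' a'E; apply/eqP; rewrite eqn_leq; apply/andP; split.
  rewrite {1}/wsize msizeE; apply/bigmax_leqP_seq => m + _.
  rewrite mcoeff_msupp mcoeff_wmap => nz; apply: msize_mdeg_lt.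
  by rewrite mcoeff_msupp mcoeff_wmap; apply: contraNneq nz => /ker ->.
have [->|a0] := eqVneq (wmap f a') 0; first by rewrite wsize0.
rewrite {1}/wsize -(mlead_deg a0); apply: msize_mdeg_lt.
rewrite mcoeff_msupp mcoeff_wmap; apply: (Hc k psi ker psic).
by rewrite -mcoeff_wmap; apply/mapP; exists (wmap f a') => //; rewrite mem_filter a0.
Qed.

End WeylSpecialization.

Section Reduction.
Context (K k : fieldType) (B : comNzRingType) (n : nat).
Context (f : {rmorphism B -> K}) (psi : {rmorphism B -> k}).
Hypothesis ker : forall b, f b = 0 -> psi b = 0.

(* The graph of the reduction map from A_n(f(B)) to A_n(k). *)
Definition reduces (a : weyl K n) (a' : weyl k n) :=
  exists b, wmap f b = a /\ wmap psi b = a'.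

Lemma reduces_uniq a a' a'' : reduces a a' -> reduces a a'' -> a' = a''.
Proof.
case=> b [ba ba'] [c [ca ca']]; apply/eqP; rewrite -subr_eq0 -ba' -ca' -rmorphB.
apply/eqP/mpolyP => m; rewrite mcoeff0 mcoeff_wmap; apply: ker.
by rewrite -mcoeff_wmap rmorphB /= ba ca subrr mcoeff0.
Qed.

Lemma reduces0 : reduces 0 0.
Proof. by exists 0; rewrite !raddf0. Qed.

Lemma reduces1 : reduces 1 1.
Proof. by exists 1; rewrite !rmorph1. Qed.

Lemma reducesD a a' b b' : reduces a a' -> reduces b b' -> reduces (a + b) (a' + b').
Proof. by case=> c [<- <-] [d [<- <-]]; exists (c + d); rewrite !raddfD. Qed.

Lemma reducesN a a' : reduces a a' -> reduces (- a) (- a').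
Proof. by case=> c [<- <-]; exists (- c); rewrite !raddfN. Qed.

Lemma reducesM a a' b b' : reduces a a' -> reduces b b' -> reduces (a * b) (a' * b').
Proof. by case=> c [<- <-] [d [<- <-]]; exists (c * d); rewrite !rmorphM. Qed.

Lemma reducesMn a a' j : reduces a a' -> reduces (a *+ j) (a' *+ j).
Proof. by case=> c [<- <-]; exists (c *+ j); rewrite !raddfMn. Qed.

Lemma reducesZ b a a' : reduces a a' -> reduces (f b *: a) (psi b *: a').
Proof. by case=> c [<- <-]; exists (b *: c); rewrite !wmapZ. Qed.

Lemma reduces_gen g : reduces (wgen g) (wgen g).
Proof. by exists (wgen g); rewrite !wmapX. Qed.

Lemma reduces_sum (I : Type) (r : seq I) (P : pred I) F F' :
  (forall i, reduces (F i) (F' i)) ->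
  reduces (\sum_(i <- r | P i) F i) (\sum_(i <- r | P i) F' i).
Proof.
move=> H; elim/big_ind2: _ => //; first exact: reduces0.
by move=> *; apply: reducesD.
Qed.

Lemma reduces_iter_ad y y' a a' j : reduces y y' -> reduces a a' ->
  reduces (iter j (ad y) a) (iter j (ad y') a').
Proof.
move=> yy aa; elim: j => //= j IH.
by apply: reducesD; [|apply: reducesN]; apply: reducesM.
Qed.

Section Endomorphism.
Context (phi : {lrmorphism weyl K n -> weyl K n}).
Hypothesis phi_reduces : forall g, exists a', reduces (phi (wgen g)) a'.

(** Reduction is single-valued and respects ring operations, so the reduced images of the generators
    still satisfy the Weyl relations and the universal property applies. *)
Lemma reduced_endomorphism : exists phi' : {lrmorphism weyl k n -> weyl k n},
  forall a a', reduces a a' -> reduces (phi a) (phi' a').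
Proof.
pose y' g := proj1_sig (constructive_indefinite_description _ (phi_reduces g)).
have y'E g : reduces (phi (wgen g)) (y' g).
  by rewrite /y'; case: constructive_indefinite_description.
have y'W : weyl_family y'.
  move=> g h; apply: (@reduces_uniq (wsign (weyl K n) g * (wconj g == h)%:R)).
    rewrite -(lrmorph_weyl_family phi g h).
    by apply: reducesD; [|apply: reducesN]; apply: reducesM.
  apply: reducesM; last by apply: reducesMn; apply: reduces1.
  by rewrite /wsign; case: split => _; [apply: reducesN|]; apply: reduces1.
have [phi' phi'E] := weyl_hom_ex y'W.
exists phi' => a a' [b [<- <-]]; elim/weyl_ind: b => [|c b b' IH IH'|g b IH].
- by rewrite !rmorph1; apply: reduces1.
- rewrite !raddfD /= !wmapZ !linearZ_LR; apply: reducesD => //; exact: reducesZ.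
- by rewrite !rmorphM /= !wmapX !phi'E; apply: reducesM => //; apply: y'E.
Qed.

Context (r : nat) (a : 'I_r -> weyl K n).
Hypothesis a1 : exists c c', (forall i, reduces (c i) (c' i)) /\
  1 = \sum_(i < r) phi (c i) * a i.
Hypothesis ag : forall j g, exists c c', (forall i, reduces (c i) (c' i)) /\
  a j * wgen g = \sum_(i < r) phi (c i) * a i.

Let spanned (b : weyl K n) := exists c c', (forall i, reduces (c i) (c' i)) /\
  b = \sum_(i < r) phi (c i) * a i.

Let spannedD b b' : spanned b -> spanned b' -> spanned (b + b').
Proof.
case=> c [c' [cc' ->]] [d [d' [dd' ->]]].
exists (fun i => c i + d i), (fun i => c' i + d' i); split.
  by move=> i; apply: reducesD.
by rewrite -big_split; apply: eq_bigr => i _; rewrite raddfD mulrDl.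
Qed.

Let spanned0 : spanned 0.
Proof.
exists (fun=> 0), (fun=> 0); split; first by move=> i; apply: reduces0.
by rewrite big1 // => i _; rewrite raddf0 mul0r.
Qed.

Let spannedM s s' b : reduces s s' -> spanned b -> spanned (phi s * b).
Proof.
move=> ss' [c [c' [cc' ->]]]; exists (fun i => s * c i), (fun i => s' * c' i); split.
  by move=> i; apply: reducesM.
by rewrite mulr_sumr; apply: eq_bigr => i _; rewrite rmorphM mulrA.
Qed.

Let spanned_gen b g : spanned b -> spanned (b * wgen g).
Proof.
case=> c [c' [cc' ->]]; rewrite mulr_suml; elim/big_ind: _ => // i _.
by rewrite -mulrA; apply: spannedM (cc' i) _; apply: ag.
Qed.

Let spannedZ b d : spanned d -> spanned (f b *: d).
Proof.
have -> : f b *: d = phi (f b *: 1) * d by rewrite linearZ_LR rmorph1 -scalerAl mul1r.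
by apply: spannedM; apply: reducesZ; apply: reduces1.
Qed.

(** Start from 1 by [a1] and multiply on the right by generators: by [ag] the coordinates never
    leave the ring f(B). *)
Lemma reduces_spanned b b' : reduces b b' -> spanned b.
Proof.
case=> c [<- _]; rewrite -[wmap f c]mul1r; move: (a1 : spanned 1); move: 1.
elim/weyl_ind: c => [|e c d IH IH'|g c IH] s Hs.
- by rewrite rmorph1 mulr1.
- rewrite raddfD /= wmapZ mulrDr -scalerAr; apply: spannedD; last exact: IH'.
  by apply: spannedZ; apply: IH.
- by rewrite rmorphM /= wmapX mulrA; apply: IH; apply: spanned_gen.
Qed.

(* Elements reducing to 0 are combinations with coefficients reducing to 0, so
   that linear forms defined over f(B) pass to the reduction. *)
Lemma reduces_spanned0 b : reduces b 0 -> exists c, (forall i, reduces (c i) 0) /\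
  b = \sum_(i < r) phi (c i) * a i.
Proof.
case=> c [<- c0].
have -> : wmap f c = \sum_(m <- msupp c) f (c : {mpoly B[n + n]})@_m *: ('X_[m] : weyl K n).
  rewrite {1}[c]mpolyE raddf_sum; apply: eq_bigr => m _.
  by rewrite [LHS]wmapZ wmapX.
elim/big_ind: _ => [|b1 b2 [c1 [H1 ->]] [c2 [H2 ->]]|m _].
- exists (fun=> 0); split; first by move=> i; apply: reduces0.
  by rewrite big1 // => i _; rewrite raddf0 mul0r.
- exists (fun i => c1 i + c2 i); split.
    by move=> i; rewrite -[0]addr0; apply: reducesD.
  by rewrite -big_split; apply: eq_bigr => i _; rewrite raddfD mulrDl.
- have [|e [e' [ee' E]]] := @reduces_spanned ('X_[m]) ('X_[m]).
    by exists 'X_[m]; rewrite !wmapX.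
  exists (fun i => f (c : {mpoly B[n + n]})@_m *: e i); split.
    move=> i; rewrite -(scale0r (e' i)); have := reducesZ c@_m (ee' i).
    by rewrite -(mcoeff_wmap psi) c0 mcoeff0.
  by rewrite E scaler_sumr; apply: eq_bigr => i _; rewrite linearZ_LR -scalerAl.
Qed.

End Endomorphism.

End Reduction.

(** * Endomorphisms over whose image the algebra is finite *)

Lemma iter_ad_leibniz (A : nzRingType) (y u v : A) m :
  iter m (ad y) (u * v) =
  \sum_(j < m.+1) (iter j (ad y) u * iter (m - j) (ad y) v) *+ 'C(m, j).
Proof.
elim: m => [|m IH]; first by rewrite big_ord1 /= mulr1n.
rewrite iterS {}IH raddf_sum.
pose U j := iter j (ad y) u; pose V j := iter j (ad y) v.
rewrite (eq_bigr (fun j : 'I_m.+1 =>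
   (U j.+1 * V (m - j)%N) *+ 'C(m, j) + (U j * V (m.+1 - j)%N) *+ 'C(m, j))); last first.
  move=> j _; rewrite raddfMn -mulrnDl subSn; last by rewrite -ltnS.
  by congr (_ *+ _); apply: adM.
rewrite big_split /=.
have -> : \sum_(j < m.+1) (U j * V (m.+1 - j)%N) *+ 'C(m, j) =
    \sum_(j < m.+2) (U j * V (m.+1 - j)%N) *+ 'C(m, j).
  by rewrite [RHS]big_ord_recr /= bin_small // mulr0n addr0.
rewrite [X in _ + X]big_ord_recl [RHS]big_ord_recl /= !bin0 addrCA; congr (_ + _).
rewrite -big_split; apply: eq_bigr => j _; rewrite /= /bump /= add1n subSS.
by rewrite binS mulrnDr addrC.
Qed.

Section Span.
Context (K : fieldType) (n : nat) (phi : {lrmorphism weyl K n -> weyl K n}).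
Local Notation D := (weyl K n).

(** A left combination over S, with its coefficients recorded by their preimages under [phi]. *)
Definition phicomb e (c : 'rV[D]_e) (u : 'cV[D]_e) : D := (map_mx phi c *m u) 0 0.

Lemma phicombE e c (u : 'cV[D]_e) : phicomb c u = \sum_i phi (c 0 i) * u i 0.
Proof. by rewrite /phicomb mxE; apply: eq_bigr => i _; rewrite mxE. Qed.

Lemma phicombD e c d (u : 'cV[D]_e) : phicomb (c + d) u = phicomb c u + phicomb d u.
Proof. by rewrite /phicomb map_mxD mulmxDl mxE. Qed.

Lemma phicombZ e s c (u : 'cV[D]_e) : phicomb (s *: c) u = phi s * phicomb c u.
Proof. by rewrite /phicomb map_mxZ -scalemxAl mxE. Qed.

Lemma phicomb0 e (u : 'cV[D]_e) : phicomb 0 u = 0.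
Proof. by rewrite /phicomb map_mx0 mul0mx mxE. Qed.

Lemma phicombN e c (u : 'cV[D]_e) : phicomb (- c) u = - phicomb c u.
Proof. by rewrite -scaleN1r phicombZ rmorphN rmorph1 mulN1r. Qed.

Lemma phicomb_mul e e' c (M : 'M[D]_(e, e')) u :
  phicomb (c *m M) u = phicomb c (map_mx phi M *m u).
Proof. by rewrite /phicomb map_mxM mulmxA. Qed.

Lemma phicomb_delta e i (u : 'cV[D]_e) : phicomb (delta_mx 0 i) u = u i 0.
Proof.
by rewrite /phicomb map_delta_mx -rowE mxE.
Qed.

Definition phi_indep e (u : 'cV[D]_e) := forall c, phicomb c u = 0 -> c = 0.

Context (r : nat) (a : 'cV[D]_r) (a_span : forall b, exists c, b = phicomb c a).

Lemma span_matrix e (u : 'cV[D]_e) : exists C : 'M[D]_(e, r), u = map_mx phi C *m a.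
Proof.
pose row_of b := proj1_sig (constructive_indefinite_description _ (a_span b)).
have rowE b : b = phicomb (row_of b) a.
  by rewrite /row_of; case: constructive_indefinite_description.
exists (\matrix_(i, j) row_of (u i 0) 0 j); apply/colP => i.
rewrite {1}[u i 0]rowE phicombE mxE; apply: eq_bigr => j _.
by rewrite !mxE.
Qed.

Lemma phi_dependent e (u : 'cV[D]_e) : (r < e)%N ->
  exists c, c != 0 /\ phicomb c u = 0.
Proof.
move=> lt; have [C ->] := span_matrix u; have [c [c0 cC]] := ore_left C lt.
by exists c; split=> //; rewrite -phicomb_mul cC phicomb0.
Qed.

Lemma phi_indep_max : exists e (u : 'cV[D]_e), phi_indep u /\
  forall b, exists t c, t != 0 /\ phi t * b = phicomb c u.
Proof.
apply: NNPP => H.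
have all e : exists u : 'cV[D]_e, phi_indep u.
  elim: e => [|e [u iu]]; first by exists 0 => c _; apply: thinmx0.
  apply: NNPP => H'; apply: H; exists e, u; split => // b.
  apply: NNPP => H''; apply: H'; rewrite -addn1; exists (col_mx u b%:M) => c.
  rewrite -(hsubmxK c) /phicomb map_row_mx mul_row_col mxE -/(phicomb _ _) => E.
  have E2 : (map_mx phi (rsubmx c) *m (b%:M : 'M_1)) 0 0 = phi (rsubmx c 0 0) * b.
    by rewrite mxE big_ord1 !mxE eqxx mulr1n.
  have t0 : rsubmx c 0 0 = 0.
    apply/eqP/negPn/negP => nz; apply: H''; exists (rsubmx c 0 0), (- lsubmx c).
    split => //; rewrite phicombN; apply/eqP; rewrite -addr_eq0 addrC.
    by rewrite -E2 E.
  have r0 : rsubmx c = 0 by apply/rowP => i; rewrite ord1 t0 mxE.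
  have /iu -> : phicomb (lsubmx c) u = 0 by rewrite -[RHS]E E2 t0 rmorph0 mul0r addr0.
  by rewrite r0 row_mx0.
have [u iu] := all r.+1; have [c [c0 /iu cE]] := phi_dependent u (ltnSn r).
by rewrite cE eqxx in c0.
Qed.

(* [hc] lists the values of h on the generators a; it exists because rows
   independent from a submodule of W^r are separated from it by a column. *)
Lemma phi_functional e (u : 'cV[D]_e) (i0 : 'I_e) : phi_indep u ->
  exists (h : {additive D -> D}) (hc : 'cV[D]_r),
    [/\ forall s b, h (phi s * b) = s * h b,
        forall c, h (phicomb c a) = (c *m hc) 0 0,
        forall i, i != i0 -> h (u i 0) = 0 & h (u i0 0) != 0].
Proof.
move=> iu.
(* With w = 0 this contains all relations between the generators [a], so a column killing [N]
   defines a form on A. *)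
pose N (rho : 'rV[D]_r) := exists w : 'rV[D]_e, w 0 i0 = 0 /\ phicomb rho a = phicomb w u.
have [v vE] := a_span (u i0 0).
have [||| hc [Nhc vhc]] := @ore_functional K n r N v.
- move=> t [w [w0 E]].
  have : phicomb (t *: delta_mx 0 i0 - w) u = 0.
    by rewrite phicombD phicombN phicombZ phicomb_delta vE -phicombZ E subrr.
  by move/iu/rowP/(_ i0); rewrite !mxE w0 !eqxx subr0 mulr1.
- move=> c x y [w [w0 wE]] [w' [w'0 w'E]]; exists (c *: w + w'); split.
    by rewrite !mxE w0 w'0 mulr0 addr0.
  by rewrite !phicombD !phicombZ wE w'E.
- by exists 0; rewrite mxE !phicomb0.
pose row_of b := proj1_sig (constructive_indefinite_description _ (a_span b)).
have rowE b : b = phicomb (row_of b) a.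
  by rewrite /row_of; case: constructive_indefinite_description.
have wd c d : phicomb c a = phicomb d a -> c *m hc = d *m hc.
  move=> E; apply/eqP; rewrite -subr_eq0 -mulmxBl; apply/eqP/Nhc.
  by exists 0; rewrite mxE phicomb0 phicombD phicombN E subrr.
pose h0 b := (row_of b *m hc) 0 0.
have h0E c : h0 (phicomb c a) = (c *m hc) 0 0.
  by rewrite /h0 (wd _ c) // -rowE.
have h0add : additive h0.
  move=> b b'; rewrite [b in LHS]rowE [b' in LHS]rowE -phicombN -phicombD h0E.
  by rewrite mulmxBl mxE [X in _ + X]mxE.
pose h : {additive D -> D} := HB.pack h0 (GRing.isZmodMorphism.Build D D h0 h0add).
exists h, hc; split => //.
- by move=> s b; rewrite [b in LHS]rowE -phicombZ [LHS]h0E -scalemxAl mxE.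
- move=> i ii0; have [c cE] := a_span (u i 0); rewrite cE [LHS]h0E.
  rewrite (Nhc c) ?mxE //; exists (delta_mx 0 i); rewrite phicomb_delta cE; split => //.
  by rewrite mxE eqxx eq_sym (negbTE ii0).
- rewrite vE [h _]h0E; apply: contraNneq vhc => z.
  by apply/eqP/colP => j; rewrite !ord1 z mxE.
Qed.

End Span.

Lemma ad_ad (A : nzRingType) (u v w : A) :
  ad u (ad v w) = ad (ad u v) w + ad v (ad u w).
Proof.
rewrite [ad v w]/ad raddfB /= !adM; set p := ad u v; set q := ad u w.
by rewrite [ad p w]/ad [ad v q]/ad opprD [- _ - _]addrC addrACA.
Qed.

Lemma iter_ad_pow (A : nzRingType) (y z u : A) N :
  ad y z = 1 -> ad y u = 0 -> iter N (ad y) (z ^+ N * u) = u *+ N`!.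
Proof.
move=> yz yu; have adX j : ad y (z ^+ j.+1) = z ^+ j *+ j.+1.
  elim: j => [|j IH]; first by rewrite expr1 yz expr0 mulr1n.
  by rewrite exprS adM yz mul1r IH mulrnAr -exprS -mulrS.
elim: N => [|N IH]; first by rewrite mul1r fact0 mulr1n.
rewrite iterSr adM yu mulr0 addr0 adX mulrnAl.
have iterMn w j : iter N (ad y) (w *+ j) = iter N (ad y) w *+ j.
  by elim: (N) => //= k ->; rewrite raddfMn.
by rewrite iterMn IH -mulrnA factS mulnC.
Qed.

(** * Local nilpotence, centralizer and surjectivity in characteristic 0 *)

Section Char0.
Context (K : fieldType) (charK : [pchar K] =i pred0) (n : nat).
Context (phi : {lrmorphism weyl K n -> weyl K n}).
Local Notation D := (weyl K n).

Let factK (m : 'X_{1..n + n}) g : ((m g)`!)%:R != 0 :> K.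
Proof. by have /pcharf0P -> := charK; rewrite -lt0n fact_gt0. Qed.

(** Scalars centralize the image, so the images of distinct monomials are independent over K. *)
Lemma phi_eq0 (t : D) : phi t = 0 -> t = 0.
Proof.
move=> pt; have := mpolywE (leqnn (msize (t : {mpoly K[n + n]}))); set N := msize _ => tE.
pose C (m : bmultinom (n + n) N) : D := t@_m *: 1.
have C0 : forall m, C m = 0.
  apply: (@centralizer_indep K n phi _ (fun m : bmultinom (n + n) N => m : 'X_{1..n + n}) C).
  - exact: val_inj.
  - by move=> *; apply: factK.
  - by move=> m g; rewrite /C /ad -scalerAr -scalerAl mulr1 mul1r subrr.
  rewrite -[RHS]pt [in RHS]tE [in RHS]raddf_sum; apply: eq_bigr => m _.
  by rewrite /C -scalerAl mul1r [RHS]linearZ_LR.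
rewrite [t]tE big1 // => m _.
have /eqP := C0 m; rewrite scaler_eq0 oner_eq0 orbF => /eqP ->.
by rewrite scale0r.
Qed.

Lemma phi_mul_eq0 (t b : D) : t != 0 -> phi t * b = 0 -> b = 0.
Proof.
move=> t0 /eqP; rewrite wmul_eq0 => /orP[/eqP/phi_eq0 t0'|/eqP //].
by rewrite t0' eqxx in t0.
Qed.

Context (r : nat) (a : 'cV[D]_r) (a_span : forall b, exists c, b = phicomb phi c a).

Section AdNilpotent.
Context (g : 'I_(n + n)) (x : D) (x0 : x != 0).
Local Notation y := (phi (wgen g)).
Let u e : 'cV[D]_e := \col_i iter i (ad y) x.

(** Take the shortest dependent initial segment of brackets, which has at most r + 1 members.
    Minimality makes the last coefficient nonzero, and e > 0 because x is not torsion. *)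
Lemma ad_relation : exists e (s : nat -> D),
  [/\ (0 < e)%N, s e != 0, phi_indep phi (u e) &
      \sum_(i < e.+1) phi (s i) * iter i (ad y) x = 0].
Proof.
have [e [ie mine]] := @exists_minimal nat id (fun e => ~ phi_indep phi (u e))
  (ex_intro _ r.+1 (fun ir => let: ex_intro c (conj c0 cE) := phi_dependent a_span (u r.+1) (ltnSn r) in
     negP c0 (introT eqP (ir c cE)))).
case: e => [|e] in ie mine; first by case: ie => c _; apply: thinmx0.
have iu : phi_indep phi (u e) by apply: NNPP => /mine; rewrite ltnn.
have [c [c0 cE]] : exists c, c != 0 /\ phicomb phi c (u e.+1) = 0.
  apply: NNPP => H; apply: ie => c cE; apply/eqP/negPn/negP => c0; apply: H.
  by exists c.
pose s i := c 0 (inord i).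
have rel : \sum_(i < e.+1) phi (s i) * iter i (ad y) x = 0.
  rewrite -[RHS]cE phicombE; apply: eq_bigr => i _.
  by rewrite /s inord_val mxE.
have se : s e != 0.
  apply: contraNneq c0 => se; move: rel; rewrite big_ord_recr /= se rmorph0 mul0r addr0.
  move=> rel'; have z : \row_(i < e) s i = 0.
    by apply: iu; rewrite -[RHS]rel' phicombE; apply: eq_bigr => i _; rewrite !mxE.
  apply/eqP/rowP => i; rewrite mxE; have [lt|le] := ltnP i e.
    by have /rowP/(_ (Ordinal lt)) := z; rewrite !mxE /s inord_val.
  have -> : i = inord e; last exact: se.
  by apply: val_inj; rewrite /= inordK //; apply/eqP; rewrite eqn_leq le -ltnS ltn_ord.
exists e, s; split => //; rewrite lt0n; apply: contraNneq x0 => e0.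
move: rel se; rewrite e0 big_ord1 /= => rel se; apply/eqP; exact: phi_mul_eq0 se rel.
Qed.

Lemma functional_recurrence e (s : nat -> D) (h : {additive D -> D}) :
  (forall t b, h (phi t * b) = t * h b) ->
  \sum_(i < e.+1) phi (s i) * iter i (ad y) x = 0 ->
  ad_recurrence g e s (fun m => h (iter m (ad y) x)).
Proof.
move=> hphi rel m; have := congr1 (fun b => h (iter m (ad y) b)) rel.
rewrite iter_ad_sum raddf_sum /= (_ : iter m (ad y) 0 = 0); last first.
  by elim: (m) => //= j ->; rewrite raddf0.
rewrite raddf0 => E; rewrite -[RHS]E; apply: eq_bigr => i _.
rewrite iter_ad_leibniz raddf_sum; apply: eq_bigr => j _.
rewrite raddfMn /= -rmorph_iter_ad hphi -iterD; congr (_ * h (iter _ _ _) *+ _).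
by rewrite [RHS]addnC addnBA // -ltnS.
Qed.

Lemma regular_relation e (s : nat -> D) : (0 < e)%N -> s e != 0 -> phi_indep phi (u e) ->
  \sum_(i < e.+1) phi (s i) * iter i (ad y) x = 0 ->
  forall i, (i < e)%N -> s i != 0 -> (wsize (s i) + e <= wsize (s e) + i)%N.
Proof.
move=> e0 se iu rel i1 lt_i1 si1; rewrite leqNgt; apply/negP => irr.
have lt_e1 : (e.-1 < e)%N by rewrite prednK.
have [h [hc [hphi hcE h0 h1]]] := phi_functional a_span (Ordinal lt_e1) iu.
pose b m := h (iter m (ad y) x).
have rec : ad_recurrence g e s b by apply: functional_recurrence.
have [c1 c1E] := a_span 1.
pose C j g' := proj1_sig (constructive_indefinite_description _ (a_span (a j 0 * wgen g'))).
have CE j g' : a j 0 * wgen g' = phicomb phi (C j g') a.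
  by rewrite /C; case: constructive_indefinite_description.
(* [c1] and [C] are needed for [h] to respect reduction, [hc] to reduce its values; the degrees of
   the [s i] and the nonvanishing of [b e.-1] must survive for the contradiction. *)
pose E : seq D := x :: b e.-1 :: [seq phi (wgen g') | g' : 'I_(n + n)] ++
  [seq hc i 0 | i : 'I_r] ++ [seq s i | i : 'I_e.+1] ++ [seq c1 0 i | i : 'I_r] ++
  [seq C t.1.1 t.1.2 0 t.2 | t : ('I_r * 'I_(n + n)) * 'I_r].
have [B [f [k [p [psi [pk ker imE sizeE]]]]]] := weyl_specialization E charK.
have redE t : t \in E -> exists t', reduces f psi t t'.
  by case/imE => t' <-; exists (wmap psi t'), t'.
have redsz t t' : t \in E -> reduces f psi t t' -> wsize t' = wsize t.
  by move=> tE [t0 [t0E t0E']]; rewrite -t0E' sizeE t0E.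
have inx : x \in E by rewrite mem_head.
have inb : b e.-1 \in E by rewrite !inE eqxx orbT.
have inphi g' : phi (wgen g') \in E.
  by rewrite !inE mem_cat (codom_f (fun g' => phi (wgen g'))) !orbT.
have inhc i : hc i 0 \in E.
  by rewrite !inE !mem_cat (codom_f (fun i => hc i 0)) !orbT.
have ins i : (i < e.+1)%N -> s i \in E.
  by move=> lt; rewrite !inE !mem_cat (codom_f (fun i : 'I_e.+1 => s i) (Ordinal lt)) !orbT.
have inc1 i : c1 0 i \in E.
  by rewrite !inE !mem_cat (codom_f (fun i => c1 0 i)) !orbT.
have inC j g' i : C j g' 0 i \in E.
  by rewrite !inE !mem_cat (codom_f (fun t : ('I_r * 'I_(n + n)) * 'I_r => C t.1.1 t.1.2 0 t.2) (j, g', i)) !orbT.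
have redphi g' := redE _ (inphi g').
have [phi' phi'E] := reduced_endomorphism ker redphi.
have choose_red (c : 'I_r -> D) : (forall i, c i \in E) ->
    exists c', forall i, reduces f psi (c i) (c' i).
  move=> cE; exists (fun i => proj1_sig (constructive_indefinite_description _ (redE _ (cE i)))).
  by move=> i; case: constructive_indefinite_description.
have a1 : exists c c' : 'I_r -> _, (forall i, reduces f psi (c i) (c' i)) /\
    1 = \sum_(i < r) phi (c i) * a i 0.
  have [c' c'E] := choose_red _ inc1.
  by exists (fun i => c1 0 i), c'; split=> //; rewrite {1}c1E phicombE.
have ag j g' : exists c c' : 'I_r -> _, (forall i, reduces f psi (c i) (c' i)) /\
    a j 0 * wgen g' = \sum_(i < r) phi (c i) * a i 0.
  have [c' c'E] := choose_red _ (inC j g').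
  by exists (fun i => C j g' 0 i), c'; split=> //; rewrite CE phicombE.
have [hc' hc'E] := choose_red _ inhc.
have hsum (c : 'I_r -> D) : h (\sum_(i < r) phi (c i) * a i 0) = \sum_(i < r) c i * hc i 0.
  transitivity (h (phicomb phi (\row_i c i) a)).
    by congr (h _); rewrite phicombE; apply: eq_bigr => i _; rewrite mxE.
  by rewrite hcE mxE; apply: eq_bigr => i _; rewrite mxE.
have hred t t' : reduces f psi t t' -> exists t'', reduces f psi (h t) t''.
  move=> /(reduces_spanned a1 ag)[c [c' [cc' ->]]]; rewrite hsum.
  by exists (\sum_i c' i * hc' i); apply: reduces_sum => i; apply: reducesM.
(* No form is constructed modulo p: knowing that [h] sends elements reducing to 0 to such elements
   is enough to transfer the vanishing of high brackets to [beta]. *)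
have hred0 t : reduces f psi t 0 -> reduces f psi (h t) 0.
  move=> /(reduces_spanned0 a1 ag)[c [cc' ->]]; rewrite hsum.
  have -> : 0 = \sum_(i < r) 0 * hc' i by rewrite big1 // => i _; rewrite mul0r.
  by apply: reduces_sum => i; apply: reducesM.
have [x' x'E] := redE _ inx.
have ydx m : reduces f psi (iter m (ad y) x) (iter m (ad (phi' (wgen g))) x').
  by apply: reduces_iter_ad => //; apply: phi'E; apply: reduces_gen.
pose beta m := proj1_sig (constructive_indefinite_description _ (hred _ _ (ydx m))).
have betaE m : reduces f psi (b m) (beta m).
  by rewrite /beta; case: constructive_indefinite_description.
have s'_ex i : exists s', (i < e.+1)%N -> reduces f psi (s i) s'.
  by have [/ins/redE[s' s'E]|_] := ltnP i e.+1; [exists s' | exists 0].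
pose s' i := proj1_sig (constructive_indefinite_description _ (s'_ex i)).
have s'E i : (i < e.+1)%N -> reduces f psi (s i) (s' i).
  by rewrite /s'; case: constructive_indefinite_description.
have sz i : (i < e.+1)%N -> wsize (s' i) = wsize (s i).
  by move=> lt; apply: redsz (s'E i lt); apply: ins.
have rec' : ad_recurrence g e s' beta.
  move=> m; apply: (reduces_uniq ker _ (reduces0 n f psi)).
  rewrite -[in X in reduces _ _ X _](rec m); apply: reduces_sum => i; apply: reduces_sum => j.
  apply: reducesMn; apply: reducesM; last exact: betaE.
  by apply: reduces_iter_ad; [apply: reduces_gen | apply: s'E].
have lt_i1' : (i1 < e.+1)%N by apply: ltnW.
apply: (@irregular_recurrence k n g e s' beta rec' p i1).
- by rewrite -wsize_gt0 sz // wsize_gt0.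
- by [].
- move=> m lt; apply: (reduces_uniq ker) (betaE m) _.
  have lt_me : (m < e)%N by apply: leq_trans lt (leq_pred _).
  have := h0 (Ordinal lt_me); rewrite mxE -val_eqE /= neq_ltn lt /= => /(_ isT) bm.
  by rewrite /b bm; apply: reduces0.
- rewrite -wsize_gt0 (redsz _ _ inb (betaE _)) wsize_gt0.
  by have := h1; rewrite mxE.
- by [].
- by rewrite -wsize_gt0 sz // wsize_gt0.
- by rewrite !sz.
move=> m le_pm; apply: (reduces_uniq ker) (betaE m) _; apply: hred0.
have := ydx m; rewrite -{2}(subnK le_pm) iterD (pchar_ad_nilpotent pk).
by rewrite (_ : iter _ _ 0 = 0) //; elim: (m - p)%N => //= j ->; rewrite raddf0.
Qed.

(** Forms dual to a maximal independent family detect 0, since A has no S-torsion. They are finitely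
    many, and each vanishes on all high brackets. *)
Lemma ad_nilpotent_neq0 : exists m, iter m (ad y) x = 0.
Proof.
have [e [s [e0 se iu rel]]] := ad_relation.
have reg := regular_relation e0 se iu rel.
have [d [v [iv maxv]]] := phi_indep_max a_span.
have H (i : 'I_d) : exists hM : {additive D -> D} * nat,
    [/\ forall t b, hM.1 (phi t * b) = t * hM.1 b,
        forall j, j != i -> hM.1 (v j 0) = 0, hM.1 (v i 0) != 0 &
        forall m, (hM.2 <= m)%N -> hM.1 (iter m (ad y) x) = 0].
  have [h [hc [hphi _ h0 h1]]] := phi_functional a_span i iv.
  have [M HM] := regular_recurrence (functional_recurrence hphi rel) se reg.
  by exists (h, M).
pose hM i := proj1_sig (constructive_indefinite_description _ (H i)).
exists (\max_i (hM i).2)%N; set m := (\max_i _)%N.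
have [t [c [t0 tE]]] := maxv (iter m (ad y) x).
have c0 : c = 0.
  apply/rowP => i; rewrite mxE.
  have [hphi h0 h1 hm] : let: hM := hM i in [/\ forall t b, hM.1 (phi t * b) = t * hM.1 b,
        forall j, j != i -> hM.1 (v j 0) = 0, hM.1 (v i 0) != 0 &
        forall m, (hM.2 <= m)%N -> hM.1 (iter m (ad y) x) = 0].
    by rewrite /hM; case: constructive_indefinite_description.
  have := congr1 (hM i).1 tE.
  rewrite hphi hm ?mulr0; last exact: (leq_bigmax (F := fun i => (hM i).2)).
  rewrite phicombE raddf_sum (bigD1 i) //= big1 ?addr0 => [|j ji]; last first.
    by rewrite hphi h0 ?mulr0.
  by rewrite hphi => /esym/eqP; rewrite wmul_eq0 (negbTE h1) orbF => /eqP.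
by apply: (phi_mul_eq0 t0); rewrite tE c0 phicomb0.
Qed.

End AdNilpotent.

Lemma ad_nilpotent g x : exists m, iter m (ad (phi (wgen g))) x = 0.
Proof.
have [->|x0] := eqVneq x 0; first by exists 0%N.
exact: ad_nilpotent_neq0.
Qed.

Lemma wsizeX (c : D) i : c != 0 -> wsize (c ^+ i) = (i * (wsize c).-1).+1.
Proof.
move=> c0; have sc : (0 < wsize c)%N by rewrite wsize_gt0.
have X0 j : c ^+ j != 0.
  by elim: j => [|j IH]; rewrite ?expr0 ?oner_eq0 // exprS wmul_eq0 negb_or c0.
elim: i => [|i IH]; first by rewrite expr0 mul0n /wsize; apply: mmeasure1.
by rewrite exprS wsizeM // IH addnS /= mulSn -[RHS]addSn prednK.
Qed.

(** The powers of [c] up to the r-th are dependent over S. Expanding the coefficients in monomials,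
    [centralizer_indep] yields a nontrivial polynomial relation for [c] over K, impossible if [c]
    has positive degree, as the degrees of its powers then increase strictly. *)
Lemma centralizer_scalar (c : D) :
  (forall g, ad (phi (wgen g)) c = 0) -> exists t : K, c = t *: 1.
Proof.
move=> cc; have [->|c0] := eqVneq c 0; first by exists 0; rewrite scale0r.
have [le|gt] := leqP (wsize c) 1.
  exists (c : {mpoly K[n + n]})@_0%MM; apply/mpolyP => m.
  rewrite [in RHS]mcoeffZ mcoeff1; have [->|m0] := eqVneq m 0%MM; first by rewrite mulr1.
  rewrite mulr0; apply: memN_msupp_eq0; apply: msize_mdeg_ge.
  by apply: leq_trans le _; rewrite lt0n mdeg_eq0.
exfalso; have [t [t0 tE]] := phi_dependent a_span (\col_(i < r.+1) c ^+ i) (ltnSn r).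
pose N := (\max_i msize (t 0%R i : {mpoly K[n + n]}))%N.
have tN i : t 0 i = \sum_(m : bmultinom (n + n) N) (t 0 i : {mpoly K[n + n]})@_m *: ('X_[m] : D).
  by apply: mpolywE; apply: (leq_bigmax (F := fun i => msize (t 0%R i : {mpoly K[n + n]}))).
pose C (m : bmultinom (n + n) N) : D :=
  \sum_(i < r.+1) (t 0 i : {mpoly K[n + n]})@_m *: c ^+ i.
have cX i g : ad (phi (wgen g)) (c ^+ i) = 0.
  elim: i => [|i IH]; first by rewrite /ad expr0 mulr1 mul1r subrr.
  by rewrite exprS adM cc IH mul0r mulr0 addr0.
have cXphi i b : phi b * c ^+ i = c ^+ i * phi b.
  elim/weyl_ind: b => [|e b b' IH IH'|g b IH].
  - by rewrite rmorph1 mulr1 mul1r.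
  - by rewrite linearP mulrDl mulrDr -scalerAl -scalerAr /= IH IH'.
  - have /eqP := cX i g; rewrite subr_eq0 => /eqP E.
    by rewrite rmorphM -mulrA IH mulrA E mulrA.
have C0 : forall m, C m = 0.
  apply: (@centralizer_indep K n phi _ (fun m : bmultinom (n + n) N => m : 'X_{1..n + n}) C).
  - exact: val_inj.
  - by move=> *; apply: factK.
  - move=> m g; rewrite /C raddf_sum big1 // => i _ /=.
    by rewrite /ad -scalerAr -scalerAl -scalerBr -/(ad _ _) cX scaler0.
  rewrite -[RHS]tE phicombE /C.
  under eq_bigr => m _ do rewrite mulr_suml.
  rewrite exchange_big; apply: eq_bigr => i _ /=.
  rewrite mxE cXphi [in RHS]tN raddf_sum mulr_sumr; apply: eq_bigr => m _.
  by rewrite /= [in RHS]linearZ_LR -scalerAl -scalerAr.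
have [i1 ti1] : exists i, t 0 i != 0.
  by apply/existsP; apply: contraNT t0 => /existsPn H; apply/eqP/rowP => i;
    rewrite mxE; apply/eqP; have := H i; rewrite negbK.
have [m tm] : exists m : bmultinom (n + n) N, (t 0 i1 : {mpoly K[n + n]})@_m != 0.
  apply/existsP; apply: contraNT ti1 => /existsPn H; rewrite [t 0 i1]tN big1 // => m _.
  by have := H m; rewrite negbK => /eqP ->; rewrite scale0r.
case: (@arg_maxnP _ i1 (fun i => (t 0 i : {mpoly K[n + n]})@_m != 0) (fun i => i : nat) tm).
move=> i ti maxi; have := C0 m; rewrite /C (bigD1 i) //= => /eqP; rewrite addr_eq0 => /eqP.
move=> /(congr1 wsize); rewrite wsizeN.
have -> : wsize ((t 0 i : {mpoly K[n + n]})@_m *: c ^+ i) = wsize (c ^+ i).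
  by apply: msizeZ.
move=> E; suff : (wsize (c ^+ i) < wsize (c ^+ i))%N by rewrite ltnn.
rewrite {1}E; apply: wsize_sum_lt => [|j ji]; first by rewrite wsizeX.
have [z|nz] := eqVneq ((t 0 j : {mpoly K[n + n]})@_m) 0.
  by rewrite z scale0r wsize0 wsizeX.
apply: leq_ltn_trans (msizeZ_le _ _) _; rewrite -!/(wsize _) !wsizeX // ltnS ltn_pmul2r; last first.
  by move: gt; size_lia.
have /= le := maxi j nz; by rewrite ltn_neqAle le andbT.
Qed.

Lemma phi_surjective_left : forall b, exists b', phi b' = b.
Proof.
(* Descent on j: for j = 2n only scalars remain, and each step frees one more generator from the
   commutation condition. *)
suff H j : (j <= n + n)%N -> forall b : D,
    (forall h : 'I_(n + n), (h < j)%N -> ad (phi (wgen h)) b = 0) -> exists b', phi b' = b.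
  by move=> b; apply: (H 0%N).
move=> le_j; rewrite -(subKn le_j); elim: (n + n - j)%N (leq_subr j (n + n)) => [|i IH] le_i b Hb.
  have [t ->] : exists t : K, b = t *: 1.
    by apply: centralizer_scalar => g; apply: Hb; rewrite subn0 ltn_ord.
  by exists (t *: 1); rewrite linearZ_LR rmorph1.
have {}IH := IH (ltnW le_i).
have lt_g : (n + n - i.+1 < n + n)%N by rewrite ltn_subrL (leq_ltn_trans _ le_i).
pose g := Ordinal lt_g; set y := phi (wgen g).
have [N HN] := ad_nilpotent g b.
elim: N => [|N IHN] in b Hb HN *; first by exists 0; rewrite raddf0 -HN.
(* The sign normalizes the bracket of [y] with the image of [w] to 1. Among all generators only [g]
   fails to commute with [w], so the conditions for h < j are kept. *)
pose w := wsign K g *: wgen (wconj g) : D.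
have comm h : ad (phi (wgen h)) (phi w) = phi (wsign K g *: (wsign D h * (wconj h == wconj g)%:R)).
  by rewrite /ad -!rmorphM -rmorphB /w -scalerAr -scalerAl -scalerBr wgen_family.
have yw : ad y (phi w) = 1.
  rewrite comm eqxx mulr1 (_ : _ *: _ = 1) ?rmorph1 //.
  by rewrite /wsign; case: split => _; rewrite ?scaleN1r ?scale1r ?opprK.
have hw (h : 'I_(n + n)) : (h < n + n - i.+1)%N -> ad (phi (wgen h)) (phi w) = 0.
  move=> lt; rewrite comm (inj_eq (inv_inj (@wconjK n))) (_ : h == g = false).
    by rewrite mulr0 scaler0 raddf0.
  by apply/negbTE; rewrite -val_eqE /= neq_ltn lt.
have hy (h : 'I_(n + n)) q : ad (phi (wgen h)) q = 0 -> ad (phi (wgen h)) (ad y q) = 0.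
  move=> hq; rewrite ad_ad hq raddf0 addr0 /y {2}/ad -!rmorphM -rmorphB wgen_family.
  rewrite /wsign; case: split => _; case: eqP => _;
    by rewrite ?mulr1 ?mulr0 ?raddf0 ?rmorphN ?rmorph1 /ad
      ?mulN1r ?mulrN1 ?mul1r ?mulr1 ?mul0r ?mulr0 ?subrr.
pose v := iter N (ad y) b.
have hv (h : 'I_(n + n)) : (h < n + n - i.+1)%N -> ad (phi (wgen h)) v = 0.
  by move=> lt; rewrite /v; elim: (N) => [|N' IHN'] /=; [apply: Hb | apply: hy].
have [v' v'E] : exists v', phi v' = v.
  apply: IH => h lt; have [lt'|] := ltnP h (n + n - i.+1); first exact: hv.
  move=> ge; have -> : h = g.
    by apply: val_inj => /=; move: lt ge (lt_g); lia.
  exact: HN.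
pose q := phi w ^+ N * v.
have hwX (h : 'I_(n + n)) j' : (h < n + n - i.+1)%N -> ad (phi (wgen h)) (phi w ^+ j') = 0.
  move=> lt; elim: j' => [|j' IHj]; first by rewrite expr0 /ad mulr1 mul1r subrr.
  by rewrite exprS adM hw // IHj mul0r mulr0 addr0.
have N0 : (N`!)%:R != 0 :> K by have /pcharf0P -> := charK; rewrite -lt0n fact_gt0.
(* The top Taylor term is removed: the N-th bracket of [q] is N! times that of [b], so the
   difference is killed by N brackets instead of N + 1. *)
have [||b' b'E] := IHN (b - (N`!)%:R^-1 *: q).
- move=> h lt; rewrite raddfB /= Hb // sub0r /ad -scalerAr -scalerAl -scalerBr -/(ad _ _).
  by rewrite /q adM hv // hwX // mul0r mulr0 addr0 scaler0 oppr0.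
- have itB p1 p2 t : iter N (ad y) (p1 - t *: p2) = iter N (ad y) p1 - t *: iter N (ad y) p2.
    have adZ q' : ad y (t *: q') = t *: ad y q'.
      by rewrite /ad -scalerAr -scalerAl -scalerBr.
    by elim: (N) => //= N' ->; rewrite raddfB /= adZ.
  by rewrite itB /q iter_ad_pow // -/v -scaler_nat scalerA mulVf // scale1r subrr.
exists (b' + (N`!)%:R^-1 *: (w ^+ N * v')).
rewrite raddfD /= b'E (linearZ_LR phi) /= (_ : phi (w ^+ N * v') = q) ?subrK //.
by rewrite rmorphM rmorphXn /= v'E.
Qed.

End Char0.

(** * The abstract Weyl algebra and its opposite *)

Section Presentation.
Context (K : fieldType) (n : nat).

Definition joint_family (B : Type) (x d : 'I_n -> B) (g : 'I_(n + n)) : B :=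
  match split g with inl i => x i | inr i => d i end.

Lemma joint_lshift (B : Type) (x d : 'I_n -> B) i : joint_family x d (lshift n i) = x i.
Proof. by rewrite /joint_family (unsplitK (inl i)). Qed.

Lemma joint_rshift (B : Type) (x d : 'I_n -> B) i : joint_family x d (rshift n i) = d i.
Proof. by rewrite /joint_family (unsplitK (inr i)). Qed.

Lemma weyl_rels_family (B : algType K) (x d : 'I_n -> B) :
  weyl_rels x d -> weyl_family (joint_family x d).
Proof.
case=> xx dd dx g h; elim/ordP: g => i; elim/ordP: h => j;
  rewrite ?joint_lshift ?joint_rshift ?wsign_lshift ?wsign_rshift
    ?wconj_lshift ?wconj_rshift.
- by rewrite xx eq_rlshift mulr0.
- by rewrite -opprB dx mulN1r eq_sym (inj_eq (@rshift_inj _ _)).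
- by rewrite dx mul1r (inj_eq (@lshift_inj _ _)).
- by rewrite dd eq_lrshift mulr0.
Qed.

Lemma wgen_rels : weyl_rels (fun i => wgen (lshift n i) : weyl K n)
  (fun i => wgen (rshift n i)).
Proof.
split=> i j; rewrite wgen_family ?wsign_lshift ?wsign_rshift ?wconj_lshift ?wconj_rshift.
- by rewrite eq_rlshift mulr0.
- by rewrite eq_lrshift mulr0.
- by rewrite mul1r (inj_eq (@lshift_inj _ _)).
Qed.

Lemma weyl_algebra_iso (A : algType K) (x d : 'I_n -> A) : is_weyl_algebra x d ->
  exists (F : {lrmorphism A -> weyl K n}) (G : {lrmorphism weyl K n -> A}),
    cancel F G /\ cancel G F.
Proof.
case=> xd univ; have [[F FE] _] := univ _ _ _ wgen_rels.
have [G GE] := weyl_hom_ex (weyl_rels_family xd).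
exists F, G; split.
  have [_ uniq] := univ _ _ _ xd.
  move=> a; apply: (uniq (G \o F : {lrmorphism A -> A}) (idfun : {lrmorphism A -> A})) => i /=.
  by have [-> ->] := FE i; rewrite !GE joint_lshift joint_rshift.
move=> a; apply: (@weyl_hom_eq K n (weyl K n) (F \o G : {lrmorphism _ -> _})
  (idfun : {lrmorphism _ -> _})).
elim/ordP => i /=; rewrite GE ?joint_lshift ?joint_rshift; first by have [-> _] := FE i.
by have [_ ->] := FE i.
Qed.

Lemma fg_left_surjective (charK : [pchar K] =i pred0) (A : algType K) (x d : 'I_n -> A)
    (HA : is_weyl_algebra x d) (phi : {lrmorphism A -> A}) :
  fg_left_over_image phi -> forall b, exists a, phi a = b.
Proof.
have [F [G [FK GK]]] := weyl_algebra_iso HA; case=> s span b.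
pose psi : {lrmorphism weyl K n -> weyl K n} := F \o (phi \o G).
have spanW w : exists c, w = phicomb psi c (\col_(i < size s) F s`_i).
  have [c cE] := span (G w); exists (\row_i F (c i)).
  rewrite phicombE -{1}(GK w) cE raddf_sum; apply: eq_bigr => i _.
  by rewrite !mxE /= FK rmorphM.
have [w wE] := phi_surjective_left charK spanW (F b).
by exists (G w); apply: (can_inj FK); rewrite -wE.
Qed.

End Presentation.

Section Opposite.
Context (K : fieldType).

HB.instance Definition _ (A : algType K) := GRing.Lmodule.copy A^c A.
HB.instance Definition _ (A : algType K) :=
  GRing.Lmodule_isLalgebra.Build K A^c (fun t a b => @scalerAr K A t b a).
HB.instance Definition _ (A : algType K) :=
  GRing.Lalgebra_isAlgebra.Build K A^c (fun t a b => @scalerAl K A t b a).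

Lemma opposite_lrmorphism (A B : algType K) (f : {lrmorphism A -> B^c}) :
  exists f' : {lrmorphism A^c -> B}, f' =1 f.
Proof.
have fM : monoid_morphism (f : A^c -> B).
  by split=> [|a b]; [apply: (rmorph1 f) | apply: (rmorphM f b a)].
have fL : linear (f : A^c -> B) by exact: (linearP f).
pose f' : {lrmorphism A^c -> B} := HB.pack (f : A^c -> B)
  (GRing.isMonoidMorphism.Build A^c B (f : A^c -> B) fM)
  (GRing.isLinear.Build K A^c B _ (f : A^c -> B) fL).
by exists f'.
Qed.

Lemma lrmorphism_opposite (A B : algType K) (f : {lrmorphism A^c -> B}) :
  exists f' : {lrmorphism A -> B^c}, f' =1 f.
Proof.
have fM : monoid_morphism (f : A -> B^c).
  by split=> [|a b]; [apply: (rmorph1 f) | apply: (rmorphM f b a)].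
have fL : linear (f : A -> B^c) by exact: (linearP f).
pose f' : {lrmorphism A -> B^c} := HB.pack (f : A -> B^c)
  (GRing.isMonoidMorphism.Build A B^c (f : A -> B^c) fM)
  (GRing.isLinear.Build K A B^c _ (f : A -> B^c) fL).
by exists f'.
Qed.

Lemma opposite_endomorphism (A : algType K) (f : {lrmorphism A -> A}) :
  exists f' : {lrmorphism A^c -> A^c}, f' =1 f.
Proof.
have fM : monoid_morphism (f : A^c -> A^c).
  by split=> [|a b]; [apply: (rmorph1 f) | apply: (rmorphM f b a)].
have fL : linear (f : A^c -> A^c) by exact: (linearP f).
pose f' : {lrmorphism A^c -> A^c} := HB.pack (f : A^c -> A^c)
  (GRing.isMonoidMorphism.Build A^c A^c (f : A^c -> A^c) fM)
  (GRing.isLinear.Build K A^c A^c _ (f : A^c -> A^c) fL).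
by exists f'.
Qed.

(** Reversing the product changes the sign of every bracket; negating the [d i] restores the
    relations. *)
Lemma weyl_rels_opposite n (B : algType K) (x d : 'I_n -> B) :
  weyl_rels x d -> weyl_rels (x : 'I_n -> B^c) (fun i => - d i : B^c).
Proof.
case=> xx dd dx; split=> i j.
- exact: xx.
- have E : (- d j) * (- d i) - (- d i) * (- d j) = 0 by rewrite !mulrNN dd.
  exact: E.
- have E : x j * (- d i) - (- d i) * x j = (i == j)%:R.
    by rewrite mulrN mulNr opprK addrC dx.
  exact: E.
Qed.

Lemma opposite_weyl_algebra n (A : algType K) (x d : 'I_n -> A) :
  is_weyl_algebra x d -> is_weyl_algebra (x : 'I_n -> A^c) (fun i => - d i : A^c).
Proof.
case=> xd univ; split; first exact: weyl_rels_opposite.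
(* Morphisms from the opposite of A to B are morphisms from A to the opposite of B, and the two
   negations cancel. *)
move=> B y e /weyl_rels_opposite ye; have [[f fE] uniq] := univ _ _ _ ye; split.
  have [f' f'E] := opposite_lrmorphism f.
  exists f' => i; rewrite raddfN /= !f'E; have [-> ->] := fE i; split => //.
  exact: (opprK (e i : B)).
move=> f1 f2 f12 a.
have [f1' f1E] := lrmorphism_opposite f1; have [f2' f2E] := lrmorphism_opposite f2.
rewrite -f1E -f2E; apply: uniq => i; rewrite !f1E !f2E; have [-> E] := f12 i; split => //.
by apply: oppr_inj; move: E; rewrite !raddfN.
Qed.

End Opposite.

Theorem theorem3p3 (K : fieldType) (charK0 : [pchar K] =i pred0) (n : nat)
    (A : algType K) (x d : 'I_n -> A) (HA : is_weyl_algebra x d)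
    (phi : {lrmorphism A -> A}) :
  fg_left_over_image phi \/ fg_right_over_image phi ->
  forall b : A, exists a : A, phi a = b.
Proof.
case=> [|[s span]]; first exact: (fg_left_surjective charK0 HA).
have [phi' phiE] := opposite_endomorphism phi.
have fg : fg_left_over_image phi'.
  exists s => b; have [c ->] := span b; exists c.
  by apply: eq_bigr => i _; rewrite phiE.
move=> b; have [a aE] := fg_left_surjective charK0 (opposite_weyl_algebra HA) fg b.
by exists a; rewrite -phiE.
Qed.
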